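(* Let $X$ be an uncountable set. Let $E=(E^0,E^1,d,r)$ be the discrete graph in which $E^0$ is the set of all finite subsets of $X$, $E^1=\{(x;v)\mid v\in E^0,\ x\in v\}$, $d((x;v))=v$ and $r((x;v))=v\setminus\{x\}$ (both $E^0$ and $E^1$ carry the discrete topology). Then the $C^*$-algebra $\mathcal{O}(E)$ is residually finite dimensional.
   Context: A topological graph $E=(E^0,E^1,d,r)$ consists of two locally compact Hausdorff spaces $E^0,E^1$, a local homeomorphism $d\colon E^1\to E^0$ and a continuous map $r\colon E^1\to E^0$; a discrete graph is one with $E^0,E^1$ discrete. Put $E^0_{\rm sce}=E^0\setminus\overline{r(E^1)}$, $E^0_{\rm fin}=\{v\in E^0: v$ has a neighborhood $V$ with $r^{-1}(V)$ compact$\}$, $E^0_{\rm rg}=E^0_{\rm fin}\setminus\overline{E^0_{\rm sce}}$ (for a discrete graph, $E^0_{\rm rg}=\{v: 0<|r^{-1}(v)|<\infty\}$). $C_d(E^1)$ is the set of continuous functions $\xi$ on $E^1$ such that $\langle\xi,\xi\rangle(v)=\sum_{e\in d^{-1}(v)}|\xi(e)|^2<\infty$ for all $v$ and $\langle\xi,\xi\rangle\in C_0(E^0)$. It is a Hilbert $C_0(E^0)$-module with $(\xi f)(e)=\xi(e)f(d(e))$, $\langle\xi,\eta\rangle(v)=\sum_{e\in d^{-1}(v)}\overline{\xi(e)}\eta(e)$, and has a left action $(\pi_r(f)\xi)(e)=f(r(e))\xi(e)$ of $C_0(E^0)$; $\pi_r(C_0(E^0_{\rm rg}))\subset\mathcal{K}(C_d(E^1))$.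 A Toeplitz $E$-pair on a $C^*$-algebra $A$ is a pair $T=(T^0,T^1)$ of a $*$-homomorphism $T^0\colon C_0(E^0)\to A$ and a linear map $T^1\colon C_d(E^1)\to A$ with $T^1(\xi)^*T^1(\eta)=T^0(\langle\xi,\eta\rangle)$ and $T^0(f)T^1(\xi)=T^1(\pi_r(f)\xi)$. It is a Cuntz-Krieger $E$-pair if $T^0(f)=\varPhi(\pi_r(f))$ for all $f\in C_0(E^0_{\rm rg})$, where $\varPhi\colon\mathcal{K}(C_d(E^1))\to A$ is the $*$-homomorphism with $\varPhi(\theta_{\xi,\eta})=T^1(\xi)T^1(\eta)^*$. $\mathcal{O}(E)$ is the $C^*$-algebra generated by the universal Cuntz-Krieger $E$-pair $t=(t^0,t^1)$. A $C^*$-algebra is residually finite dimensional if its finite dimensional representations separate its points. *)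

(* Defs.v *)
From HB Require Import structures.
From mathcomp Require Import all_boot all_order all_algebra finmap complex.
From mathcomp Require Import all_classical all_reals all_analysis.
From mathcomp Require summability.

Set Implicit Arguments.
Unset Strict Implicit.
Unset Printing Implicit Defensive.

Import Order.TTheory GRing.Theory Num.Theory.
Import numFieldNormedType.Exports.

Local Open Scope classical_set_scope.
Local Open Scope ring_scope.

(* The usual topology and norm of the complex numbers R[i]; the library only
   puts them on the alias R[i]^o. *)
HB.instance Definition _ (R : realType) := NormedModule.copy R[i] R[i]^o.

(* Not necessarily unital, hence not built on the (unital) rings of the
   library. The norm takes its values in R[i]. *)
HB.mixin Record isCStarAlgebra (R : realType) (A : Type)
    of CompleteNormedModule R[i] A := {
  cmul : A -> A -> A;
  cstar : A -> A;
  cmulA : associative cmul;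
  cmulDl : left_distributive cmul +%R;
  cmulDr : right_distributive cmul +%R;
  cmulZl : forall (k : R[i]) (a b : A), cmul (k *: a) b = k *: cmul a b;
  cmulZr : forall (k : R[i]) (a b : A), cmul a (k *: b) = k *: cmul a b;
  cnormM : forall a b : A, `|cmul a b| <= `|a| * `|b|;
  cstarK : involutive cstar;
  cstarD : {morph cstar : a b / a + b};
  cstarZ : forall (k : R[i]) (a : A), cstar (k *: a) = Num.conj k *: cstar a;
  cstarM : forall a b : A, cstar (cmul a b) = cmul (cstar b) (cstar a);
  cnorm_star : forall a : A, `|cmul (cstar a) a| = `|a| ^+ 2
}.

#[short(type="cstarAlgType")]
HB.structure Definition CStarAlgebra (R : realType) :=
  { A of isCStarAlgebra R A & CompleteNormedModule R[i] A }.

Record star_hom (R : realType) (A B : cstarAlgType R) (rho : A -> B) : Prop := {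
  star_hom_linear : forall (k : R[i]) a b, rho (k *: a + b) = k *: rho a + rho b;
  star_hom_mul : forall a b, rho (cmul a b) = cmul (rho a) (rho b);
  star_hom_star : forall a, rho (cstar a) = cstar (rho a)
}.

(* A representation on the Hilbert space C^n, B(C^n) being 'M_n with the
   conjugate transpose. *)
Record matrix_representation (R : realType) (A : cstarAlgType R) (n : nat)
    (rho : A -> 'M[R[i]]_n) : Prop := {
  matrix_rep_linear :
    forall (k : R[i]) a b, rho (k *: a + b) = k *: rho a + rho b;
  matrix_rep_mul : forall a b, rho (cmul a b) = rho a *m rho b;
  matrix_rep_star : forall a, rho (cstar a) = map_mx Num.conj (rho a)^T
}.

Definition residually_finite_dimensional (R : realType) (A : cstarAlgType R) :=
  forall a b : A, a <> b ->
    exists n (rho : A -> 'M[R[i]]_n), matrix_representation rho /\ rho a <> rho b.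

Record closed_star_subalgebra (R : realType) (A : cstarAlgType R) (S : set A) :
    Prop := {
  csa_closed : closed S;
  csa_zero : S 0;
  csa_linear : forall (k : R[i]) a b, S a -> S b -> S (k *: a + b);
  csa_mul : forall a b, S a -> S b -> S (cmul a b);
  csa_star : forall a, S a -> S (cstar a)
}.

Definition cstar_generated_by (R : realType) (A : cstarAlgType R) (G : set A) :=
  forall S : set A, closed_star_subalgebra S -> G `<=` S -> S = setT.

(* Each point has an open neighbourhood U such that f restricts to a
   homeomorphism from U onto an open set. *)
Definition local_homeomorphism (S T : topologicalType) (f : S -> T) :=
  forall x, exists U : set S,
    [/\ open U, U x, {within U, continuous f}, set_inj U f &
        forall W, open W -> W `<=` U -> open (f @` W)].

Record topological_graph := TopologicalGraph {
  vertex : topologicalType;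
  edge : topologicalType;
  dom : edge -> vertex;
  ran : edge -> vertex;
  vertex_hausdorff : hausdorff_space vertex;
  edge_hausdorff : hausdorff_space edge;
  vertex_locally_compact : locally_compact [set: vertex];
  edge_locally_compact : locally_compact [set: edge];
  dom_local_homeomorphism : local_homeomorphism dom;
  ran_continuous : continuous ran
}.

Section TopologicalGraph.
Variables (R : realType) (E : topological_graph).
Local Notation C := R[i].
Local Notation E0 := (vertex E).
Local Notation E1 := (edge E).

Definition vertex_sce : set E0 := ~` closure (range (@ran E)).

Definition vertex_fin : set E0 :=
  [set v | exists2 V, nbhs v V & compact (@ran E @^-1` V)].

Definition vertex_rg : set E0 := vertex_fin `\` closure vertex_sce.

Definition C0 : set (E0 -> C) :=
  [set f | continuous f /\
    forall eps : C, 0 < eps ->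
      exists2 K, compact K & forall v, ~ K v -> `|f v| < eps].

(* C_0(U) for U open in E0, as an ideal of C_0(E0). *)
Definition C0_on (U : set E0) : set (E0 -> C) :=
  [set f | C0 f /\ forall v, ~ U v -> f v = 0].

(* The sum over the fibre dom^-1(v) is the limit of its finite partial sums. *)
Definition inner (xi eta : E1 -> C) : E0 -> C := fun v =>
  summability.sum
    ((fun e => Num.conj (xi e) * eta e) \_ (@dom E @^-1` [set v])).

Definition Cd : set (E1 -> C) :=
  [set xi | [/\ continuous xi,
    forall v, (\esum_(e in @dom E @^-1` [set v])
                 (complex.Re (`|xi e| ^+ 2))%:E < +oo)%E &
    C0 (inner xi xi)]].

Definition Cd_norm (xi : E1 -> C) : R :=
  Num.sqrt (sup (range (fun v => complex.Re (inner xi xi v)))).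

Definition left_action (f : E0 -> C) (xi : E1 -> C) : E1 -> C :=
  fun e => f (ran e) * xi e.

Definition theta (xi eta zeta : E1 -> C) : E1 -> C :=
  fun e => xi e * inner eta zeta (dom e).

(* Operators on C_d(E^1) are represented by operators on all functions, whose
   values outside Cd are irrelevant. *)
Definition is_adjoint (S S' : (E1 -> C) -> (E1 -> C)) :=
  [/\ forall xi, Cd xi -> Cd (S xi), forall xi, Cd xi -> Cd (S' xi) &
      forall xi eta, Cd xi -> Cd eta -> inner xi (S eta) = inner (S' xi) eta].

(* K(C_d(E^1)): the adjointable operators in the closure, for the operator
   norm, of the linear span of the theta xi eta. *)
Definition compact_operator : set ((E1 -> C) -> (E1 -> C)) :=
  [set S | (exists S', is_adjoint S S') /\
    forall eps : R, 0 < eps ->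
      exists n (xi eta : 'I_n -> E1 -> C),
        (forall i, Cd (xi i) /\ Cd (eta i)) /\
        forall zeta, Cd zeta ->
          Cd_norm (S zeta - \sum_i theta (xi i) (eta i) zeta)
            <= eps * Cd_norm zeta].

Section Pair.
Variable A : cstarAlgType R.
Variables (T0 : (E0 -> C) -> A) (T1 : (E1 -> C) -> A).

(* T0 and T1 are maps on C_0(E^0) and C_d(E^1); their values on other
   functions are irrelevant. *)
Record toeplitz_pair : Prop := {
  toeplitz_linear0 : forall (k : C) f g, C0 f -> C0 g ->
    T0 (k *: f + g) = k *: T0 f + T0 g;
  toeplitz_mul0 : forall f g, C0 f -> C0 g ->
    T0 (fun v => f v * g v) = cmul (T0 f) (T0 g);
  toeplitz_star0 : forall f, C0 f ->
    T0 (fun v => Num.conj (f v)) = cstar (T0 f);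
  toeplitz_linear1 : forall (k : C) xi eta, Cd xi -> Cd eta ->
    T1 (k *: xi + eta) = k *: T1 xi + T1 eta;
  toeplitz_inner : forall xi eta, Cd xi -> Cd eta ->
    cmul (cstar (T1 xi)) (T1 eta) = T0 (inner xi eta);
  toeplitz_left : forall f xi, C0 f -> Cd xi ->
    cmul (T0 f) (T1 xi) = T1 (left_action f xi)
}.

(* Phi is the *-homomorphism K(C_d(E^1)) -> A determined by the pair. *)
Record compact_hom (Phi : ((E1 -> C) -> (E1 -> C)) -> A) : Prop := {
  compact_hom_ext : forall S S', compact_operator S -> compact_operator S' ->
    (forall xi, Cd xi -> S xi = S' xi) -> Phi S = Phi S';
  compact_hom_linear : forall (k : C) S S',
    compact_operator S -> compact_operator S' ->
    Phi (fun xi => k *: S xi + S' xi) = k *: Phi S + Phi S';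
  compact_hom_mul : forall S S', compact_operator S -> compact_operator S' ->
    Phi (S \o S') = cmul (Phi S) (Phi S');
  compact_hom_star : forall S S', compact_operator S -> compact_operator S' ->
    is_adjoint S S' -> Phi S' = cstar (Phi S);
  compact_hom_theta : forall xi eta, Cd xi -> Cd eta ->
    Phi (theta xi eta) = cmul (T1 xi) (cstar (T1 eta))
}.

Definition cuntz_krieger_pair :=
  toeplitz_pair /\
  exists2 Phi, compact_hom Phi &
    forall f, C0_on vertex_rg f -> T0 f = Phi (left_action f).

End Pair.

(* (A, t0, t1) is O(E) with its universal Cuntz-Krieger pair; this determines
   (A, t0, t1) up to isomorphism. *)
Record is_graph_algebra (A : cstarAlgType R)
    (t0 : (E0 -> C) -> A) (t1 : (E1 -> C) -> A) : Prop := {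
  graph_algebra_pair : cuntz_krieger_pair t0 t1;
  graph_algebra_generated : cstar_generated_by (t0 @` C0 `|` t1 @` Cd);
  graph_algebra_universal : forall (B : cstarAlgType R) T0 T1,
    @cuntz_krieger_pair B T0 T1 ->
    exists rho : A -> B, [/\ star_hom rho,
      forall f, C0 f -> rho (t0 f) = T0 f &
      forall xi, Cd xi -> rho (t1 xi) = T1 xi]
}.

End TopologicalGraph.

Section DiscreteGraph.
Variables (V W : choiceType) (d r : W -> V).

Lemma discrete_locally_compact (T : discreteTopologicalType) :
  locally_compact [set: T].
Proof.
move=> x _; rewrite withinET; exists [set x]; first exact: discrete_set1.
by split; [exact: compact_set1|exact: discrete_closed].
Qed.

Lemma discrete_local_homeomorphism (S T : discreteTopologicalType) (f : S -> T) :
  local_homeomorphism f.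
Proof.
move=> x; exists [set x]; split => //; first exact: discrete_open.
- by apply: continuous_subspaceT => y A /nbhs_singleton Ay;
    rewrite nbhs_principalE; exact/principal_filterP.
- by move=> y z; rewrite !inE => -> ->.
- by move=> *; exact: discrete_open.
Qed.

Lemma discrete_continuous (S : discreteTopologicalType) (T : topologicalType)
  (f : S -> T) : continuous f.
Proof.
by move=> y A /nbhs_singleton Ay; rewrite nbhs_principalE; exact/principal_filterP.
Qed.

Definition discrete_graph : topological_graph :=
  @TopologicalGraph (discrete_topology V) (discrete_topology W) d r
    (@discrete_hausdorff _) (@discrete_hausdorff _)
    (@discrete_locally_compact _) (@discrete_locally_compact _)
    (@discrete_local_homeomorphism _ _ _) (@discrete_continuous _ _ _).

End DiscreteGraph.

Section FinsetGraph.
Variable X : choiceType.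

Definition finset_edge := {e : X * {fset X} | e.1 \in e.2}.

Definition finset_graph : topological_graph :=
  @discrete_graph {fset X} finset_edge
    (fun e => (val e).2) (fun e => ((val e).2 `\ (val e).1)%fset).

End FinsetGraph.

(* Main.v *)
(* For a finite set G, restricting functions to the vertices v <= G and to the
   edges e with d(e) <= G turns the universal pair into another Toeplitz pair
   on A; since X is infinite there is no regular vertex, so it is a
   Cuntz-Krieger pair and induces a *-endomorphism psi_G of A. The image of
   psi_G lies in the C*-algebra of finitely many edges of an acyclic graph: the
   elements S_s p_v, with s a path of source v <= G and p_v the defect of the
   Cuntz-Krieger relation at v inside G, form finite frames on which psi_G acts
   by scalar matrices, and together these matrix representations are faithful
   on the image of psi_G. As *-homomorphisms are contractive, psi_G converges
   pointwise to the identity along the finite sets G, so an element killed by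
   all these representations is zero.

   Contractivity avoids spectral theory: if x is self-adjoint and |x| < 1, a
   fixed point argument gives y with (1 - y)^2 = 1 - x^2, and the image of
   x + i (1 - y) is then formally unitary. *)
Require Import Defs.
From mathcomp Require Import all_boot all_order all_algebra finmap complex.
From mathcomp Require Import all_classical all_reals all_analysis.
From mathcomp Require Import ring.
Set Implicit Arguments.
Unset Strict Implicit.
Unset Printing Implicit Defensive.
Import Order.TTheory GRing.Theory Num.Theory.
Import numFieldNormedType.Exports.
Local Open Scope classical_set_scope.
Local Open Scope ring_scope.

Local Notation "a ** b" := (cmul a b) (at level 40, left associativity).
Local Notation "a ^#" := (cstar a) (at level 2, format "a ^#").

Section CStarAlgebraTheory.
Variables (R : realType) (A : cstarAlgType R).
Local Notation C := R[i].
Implicit Types (a b c h k : A) (z : C).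

Lemma cmul0a a : 0 ** a = 0.
Proof. by apply: (addrI (0 ** a)); rewrite -cmulDl !addr0. Qed.

Lemma cmula0 a : a ** 0 = 0.
Proof. by apply: (addrI (a ** 0)); rewrite -cmulDr !addr0. Qed.

Lemma cmulNa a b : (- a) ** b = - (a ** b).
Proof. by rewrite -scaleN1r cmulZl scaleN1r. Qed.

Lemma cmulaN a b : a ** (- b) = - (a ** b).
Proof. by rewrite -scaleN1r cmulZr scaleN1r. Qed.

Lemma cmulBl a b c : (a - b) ** c = a ** c - b ** c.
Proof. by rewrite cmulDl cmulNa. Qed.

Lemma cmulBr a b c : a ** (b - c) = a ** b - a ** c.
Proof. by rewrite cmulDr cmulaN. Qed.

Lemma cmul_sumr I (r : seq I) (P : pred I) (F : I -> A) a :
  a ** (\sum_(i <- r | P i) F i) = \sum_(i <- r | P i) a ** F i.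
Proof. exact: (big_morph (cmul a) (cmulDr a) (cmula0 a)). Qed.

Lemma cmul_suml I (r : seq I) (P : pred I) (F : I -> A) a :
  (\sum_(i <- r | P i) F i) ** a = \sum_(i <- r | P i) F i ** a.
Proof.
exact: (big_morph (fun x => x ** a) (fun x y => cmulDl x y a) (cmul0a a)).
Qed.

Lemma cstar0 : (0 : A)^# = 0.
Proof. by rewrite -[X in X^#](scale0r (0 : A)) cstarZ rmorph0 scale0r. Qed.

Lemma cstarN a : (- a)^# = - a^#.
Proof. by rewrite -scaleN1r cstarZ rmorphN rmorph1 scaleN1r. Qed.

Lemma cstarB a b : (a - b)^# = a^# - b^#.
Proof. by rewrite cstarD cstarN. Qed.

Lemma cstar_sum I (r : seq I) (P : pred I) (F : I -> A) :
  (\sum_(i <- r | P i) F i)^# = \sum_(i <- r | P i) (F i)^#.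
Proof. exact: (big_morph cstar (@cstarD _ A) cstar0). Qed.

Lemma norm_cstar a : `|a^#| = `|a|.
Proof.
have le b : `|b| <= `|b^#|.
  have [->|b0] := eqVneq b 0; first by rewrite cstar0.
  have bp : 0 < `|b| by rewrite normr_gt0.
  by rewrite -(ler_pM2r bp) -expr2 -cnorm_star cnormM.
by apply/eqP; rewrite eq_le le -{2}(cstarK a) le.
Qed.

Lemma cstar_mul_eq0 a : a^# ** a = 0 -> a = 0.
Proof.
move=> e; apply/eqP; rewrite -normr_eq0 -sqrf_eq0 -cnorm_star e normr0 //.
Qed.

Lemma norm_sqr_selfadjoint h : h^# = h -> `|h ** h| = `|h| ^+ 2.
Proof. by move=> hs; rewrite -{1}hs cnorm_star. Qed.

(* h + i (1 - k) is unitary in the unitization. *)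
Lemma norm_le1_of_circle h k : h^# = h -> k^# = k -> h ** k = k ** h ->
  h ** h = k + k - k ** k -> `|h| <= 1.
Proof.
move=> hs ks hk hh.
have key b z : z ^+ 2 = -1 -> Num.conj z = - z ->
    `|h ** b + z *: (b - k ** b)| = `|b|.
  move=> z2 zc; apply: (pexpIrn (n := 2)) => //; rewrite ?nnegrE //.
  rewrite -!cnorm_star; congr (`| _ |).
  rewrite cstarD cstarZ cstarB !cstarM hs ks zc.
  rewrite !(cmulDl, cmulDr) !cmulZl !cmulZr scalerA mulNr -expr2 z2 opprK scale1r.
  rewrite !(cmulBl, cmulBr) -!cmulA !(cmulA h h) !(cmulA k k) !(cmulA h k) hk hh.
  rewrite !(cmulBl, cmulBr, cmulDl, cmulDr) !(cmulA k h).
  rewrite scaleNr !scalerBr !opprB.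
  set u := z *: _; set v := z *: _; set p := _ ** (k ** b); set q := _ ** (k ** k ** b).
  set r := b^# ** b.
  have -> : r - p + (q - p) = r - (p + p - q) by rewrite opprB opprD addrACA [RHS]addrA.
  by rewrite -(opprB v u) addrA addrNK addrC subrK.
have le b : `|h ** b| <= `|b|.
  have i2 : 'i ^+ 2 = -1 :> C by rewrite sqrCi.
  have iN2 : (- 'i) ^+ 2 = -1 :> C by rewrite sqrrN.
  have ic : Num.conj 'i = - 'i :> C by exact: conjCi.
  have iNc : Num.conj (- 'i) = - - 'i :> C by rewrite rmorphN; congr (- _).
  have := ler_normD (h ** b + 'i *: (b - k ** b)) (h ** b + (- 'i) *: (b - k ** b)).
  rewrite (key b _ i2 ic) (key b _ iN2 iNc).
  rewrite scaleNr addrACA subrr addr0 -!mulr2n normrMn.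
  by rewrite lerMn2r.
case: (eqVneq h 0) => [h0|h0]; first by rewrite h0 normr0 ler01.
have hp : 0 < `|h| by rewrite normr_gt0.
by rewrite -(ler_pM2r hp) mul1r -expr2 -norm_sqr_selfadjoint ?le.
Qed.
End CStarAlgebraTheory.

Section Limits.
Variables (R : realType) (V : completeNormedModType R[i]).
Local Notation C := R[i].

Lemma closed_of_approx (S : set V) :
  (forall a, (forall eps : C, 0 < eps -> exists2 b, S b & `|a - b| < eps) -> S a) ->
  closed S.
Proof.
move=> H a aS; apply: H => eps e0.
have [b [Sb ab]] := aS _ (nbhsx_ballx a eps e0).
by exists b => //; move: ab; rewrite -ball_normE.
Qed.

Lemma approx_of_closed (S : set V) a : closed S ->
  (forall eps : C, 0 < eps -> exists2 b, S b & `|a - b| < eps) -> S a.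
Proof.
move=> cS H; apply: cS => B /nbhs_ballP[e /= e0 eB].
have [b Sb ab] := H e e0.
by exists b; split => //; apply: eB; rewrite -ball_normE.
Qed.

Lemma eq0_of_le_eps (x : C) M : 0 <= x -> 0 <= M ->
  (forall eps : C, 0 < eps -> x <= M * eps) -> x = 0.
Proof.
move=> x0 M0 H; case: (eqVneq x 0) => // xn0.
have xp : 0 < x by rewrite lt_def xn0.
have e0 : 0 < x / (M + M + 1).
  by rewrite divr_gt0 // ltr_wpDl // addr_ge0.
have := H _ e0.
rewrite mulrA ler_pdivlMr; last by rewrite ltr_wpDl // addr_ge0.
rewrite mulrC ler_pM2r // => h.
have : M + M + 1 <= M + M by rewrite (le_trans h) // lerDl.
by rewrite gerDl (lt_geF ltr01).
Qed.

Lemma norm_eps_eq0 (a : V) M : 0 <= M ->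
  (forall eps : C, 0 < eps -> `|a| <= M * eps) -> a = 0.
Proof. by move=> M0 H; apply/eqP; rewrite -normr_eq0 (eq0_of_le_eps _ M0 H). Qed.

Lemma geometric_cvg (u : nat -> V) (q : R) : 0 <= q < 1 ->
  (forall n, `|u n.+1 - u n| <= ((q ^+ n)%:C)%C) ->
  exists l, forall eps : C, 0 < eps -> exists N, forall n, (N <= n)%N -> `|l - u n| < eps.
Proof.
move=> /andP[q0 q1] du.
have d n m : `|u (n + m)%N - u n| <= ((q ^+ n * (1 - q ^+ m) / (1 - q))%:C)%C.
  elim: m => [|m IH]; first by rewrite addn0 subrr normr0 expr0 subrr mulr0 mul0r.
  rewrite addnS -(subrKA (u (n + m)%N)) (le_trans (ler_normD _ _)) //.
  apply: (le_trans (lerD (du _) IH)).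
  rewrite -rmorphD lecR.
  suff -> : q ^+ (n + m) + q ^+ n * (1 - q ^+ m) / (1 - q) = q ^+ n * (1 - q ^+ m.+1) / (1 - q) by [].
  rewrite exprD exprS; field; by rewrite subr_eq0 eq_sym lt_eqF.
have d' n m : (n <= m)%N -> `|u n - u m| <= ((q ^+ n / (1 - q))%:C)%C.
  move=> nm; rewrite distrC -(subnKC nm) (le_trans (d _ _)) // lecR.
  by rewrite ler_pM2r ?invr_gt0 ?subr_gt0 // ler_piMr ?exprn_ge0 // gerBl exprn_ge0.
have ex (eps : C) : 0 < eps -> exists N, ((q ^+ N / (1 - q))%:C)%C < eps.
  move=> e0.
  have -> : eps = ((complex.Re eps)%:C)%C by rewrite RRe_real // gtr0_real.
  have e0' : 0 < complex.Re eps by move: e0; rewrite ltcE => /andP[].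
  have := @cvg_geometric R 1 q; rewrite ger0_norm // => /(_ q1).
  move=> /cvgrPdist_lt /(_ (complex.Re eps * (1 - q))).
  rewrite mulr_gt0 ?subr_gt0 // => /(_ isT) [N _ /(_ N)] /= /(_ (leqnn _)).
  rewrite sub0r normrN mul1r ger0_norm ?exprn_ge0 // => h.
  by exists N; rewrite ltcR ltr_pdivrMr // subr_gt0.
have : cvgn u.
  apply/cauchy_cvgP/cauchy_exP => eps e0.
  have [N hN] := ex _ e0; exists (u N); exists N => // n /= Nn.
  by rewrite -ball_normE /=; apply: le_lt_trans hN; exact: d'.
move=> /cvg_ex[l ul]; exists l => eps e0.
by move/cvgrPdist_lt : ul => /(_ _ e0) [N _ hN]; exists N => n /hN.
Qed.

End Limits.

Lemma lipschitz_closed_preimage (R : realType) (V W : completeNormedModType R[i])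
    (L : V -> W) (M : R[i]) (D : set W) :
  (forall a b, `|L a - L b| <= M * `|a - b|) -> closed D -> closed (L @^-1` D).
Proof.
move=> H cD; apply: closed_of_approx => a Ha; apply: approx_of_closed cD _ => eps e0.
have M0 : 0 <= `|M| by [].
have e1 : 0 < eps / (`|M| + 1) by rewrite divr_gt0 // ltr_wpDl.
have [b Db ab] := Ha _ e1; exists (L b) => //.
apply: le_lt_trans (H a b) _.
have [->|ne] := eqVneq a b; first by rewrite subrr normr0 mulr0.
have p : 0 < `|a - b| by rewrite normr_gt0 subr_eq0.
have M0' : 0 <= M by rewrite -(pmulr_lge0 _ p) (le_trans _ (H a b)).
apply: (@le_lt_trans _ _ ((`|M| + 1) * `|a - b|)).
  by rewrite ler_pM2r // ger0_norm // lerDl.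
by rewrite mulrC -ltr_pdivlMr // ltr_wpDl.
Qed.

Section Contractive.
Variable R : realType.
Local Notation C := R[i].

Lemma cmul_sub_le (A : cstarAlgType R) (y z : A) (r : C) :
  `|y| <= r -> `|z| <= r -> `|y ** y - z ** z| <= (r + r) * `|y - z|.
Proof.
move=> yr zr.
have -> : y ** y - z ** z = y ** (y - z) + (y - z) ** z.
  by rewrite cmulBr cmulBl addrA subrK.
rewrite (le_trans (ler_normD _ _)) // mulrDl lerD //.
  by rewrite (le_trans (cnormM _ _)) // ler_wpM2r.
by rewrite (le_trans (cnormM _ _)) // mulrC ler_wpM2r.
Qed.

(* y = 1 - sqrt (1 - x^2) as a fixed point of y |-> (x^2 + y^2)/2. *)
Lemma circle_completion (A : cstarAlgType R) (x : A) : x^# = x -> `|x| < 1 ->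
  exists y, [/\ y^# = y, x ** y = y ** x & x ** x = y + y - y ** y].
Proof.
move=> xs x1.
pose q := complex.Re `|x|.
have qE : (q%:C)%C = `|x| by rewrite RRe_real // ger0_real.
have q0 : 0 <= q by have : 0 <= `|x| := normr_ge0 x; rewrite -qE ler0c.
have q1 : q < 1 by rewrite -ltcR qE.
pose F y := 2^-1 *: (x ** x + y ** y).
pose u n := iter n F 0.
have h2 : 0 <= 2^-1 :> C by rewrite invr_ge0.
have v2 : `|2^-1 : C| = 2^-1 by rewrite ger0_norm.
have half (t : C) : 2^-1 * (t + t) = t.
  by rewrite -mulr2n -(mulr_natl t) mulKf // pnatr_eq0.
have ub n : `|u n| <= `|x|.
  elim: n => [|n IH]; first by rewrite normr0.
  rewrite /= normrZ v2 -[leRHS]half ler_wpM2l // (le_trans (ler_normD _ _)) //.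
  rewrite lerD // (le_trans (cnormM _ _)) //.
    by rewrite ler_piMl // ltW.
  rewrite -[leRHS]mul1r ler_pM // (le_trans IH) // ltW //.
have us n : (u n)^# = u n.
  elim: n => [|n IH]; first by rewrite cstar0.
  rewrite /= cstarZ cstarD !cstarM xs IH; congr (_ *: _).
  by rewrite fmorphV rmorph_nat.
have uc n : x ** u n = u n ** x.
  elim: n => [|n IH]; first by rewrite /= cmul0a cmula0.
  by rewrite /= cmulZr cmulZl cmulDr cmulDl !cmulA IH -!cmulA IH.
have du n : `|u n.+1 - u n| <= ((q ^+ n)%:C)%C.
  elim: n => [|n IH].
    rewrite expr0 subr0 (le_trans (ub 1)) // ltW //.
  have -> : ((q ^+ n.+1)%:C)%C = `|x| * ((q ^+ n)%:C)%C by rewrite -qE -rmorphM exprS.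
  rewrite /= -scalerBr normrZ v2 opprD addrACA subrr add0r.
  rewrite -[X in _ <= X * _](half `|x|) -mulrA ler_wpM2l //.
  apply: le_trans (cmul_sub_le (ub n.+1) (ub n)) _.
  by rewrite ler_wpM2l // addr_ge0.
have [y hy] := geometric_cvg (introT andP (conj q0 q1)) du.
exists y.
have yx : `|y| <= `|x| + 1.
  have [N /(_ N (leqnn _)) hN] := hy 1 ltr01.
  by rewrite -(subrK (u N) y) (le_trans (ler_normD _ _)) // addrC lerD // ltW.
have small (eps : C) : 0 < eps -> exists N, `|y - u N| < eps /\ `|y - u N.+1| < eps.
  by move=> e0; have [N hN] := hy _ e0; exists N; split; apply: hN.
split.
- apply/eqP; rewrite -subr_eq0; apply/eqP/(@norm_eps_eq0 _ _ _ 2) => // eps e0.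
  have [N [hN _]] := small _ e0.
  rewrite -(subrKA (u N)) -{1}(us N) -cstarB (le_trans (ler_normD _ _)) //.
  by rewrite norm_cstar mulr_natl mulr2n lerD // ltW // distrC.
- apply/eqP; rewrite -subr_eq0; apply/eqP/(@norm_eps_eq0 _ _ _ (`|x| + `|x|)) => [|eps e0]; first by rewrite addr_ge0.
  have [N [hN _]] := small _ e0.
  rewrite -(subrKA (x ** u N)) -cmulBr uc -cmulBl (le_trans (ler_normD _ _)) //.
  rewrite mulrDl lerD // (le_trans (cnormM _ _)) //.
    by rewrite ler_wpM2l // ltW.
  by rewrite mulrC ler_wpM2l // distrC ltW.
- have fix_ : y = F y.
    apply/eqP; rewrite -subr_eq0; apply/eqP/(@norm_eps_eq0 _ _ _ (1 + (`|x| + 1))) => [|eps e0]; first by rewrite !addr_ge0.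
    have [N [hN hN1]] := small _ e0.
    rewrite -(subrKA (u N.+1)) (le_trans (ler_normD _ _)) // mulrDl mul1r lerD //.
      exact: ltW.
    rewrite /= -scalerBr normrZ v2 opprD addrACA subrr add0r.
    rewrite -(half (`|x| + 1)) -mulrA ler_wpM2l //.
    apply: le_trans (cmul_sub_le _ yx) _.
      by rewrite (le_trans (ub N)) // lerDl.
    by rewrite ler_wpM2l ?addr_ge0 // distrC ltW.
  have : y + y = x ** x + y ** y.
    rewrite {1 2}fix_ /F -scalerDl.
    have -> : 2^-1 + 2^-1 = 1 :> C by rewrite -[RHS](half 1) mulrDr mulr1.
    by rewrite scale1r.
  by move=> ->; rewrite addrK.
Qed.

Lemma star_hom0 (A B : cstarAlgType R) (f : A -> B) : star_hom f -> f 0 = 0.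
Proof.
move=> hf; have := star_hom_linear hf (-1) 0 0.
by rewrite scaler0 addr0 scaleN1r addNr.
Qed.

Lemma star_homZ (A B : cstarAlgType R) (f : A -> B) : star_hom f ->
  forall z a, f (z *: a) = z *: f a.
Proof.
by move=> hf z a; rewrite -[z *: a]addr0 (star_hom_linear hf) (star_hom0 hf) addr0.
Qed.

Lemma star_homD (A B : cstarAlgType R) (f : A -> B) : star_hom f -> {morph f : a b / a + b}.
Proof. by move=> hf a b; rewrite -[a]scale1r (star_hom_linear hf) !scale1r. Qed.

Lemma star_homB (A B : cstarAlgType R) (f : A -> B) : star_hom f -> {morph f : a b / a - b}.
Proof.
by move=> hf a b; rewrite star_homD // -[- b]scaleN1r star_homZ // scaleN1r.
Qed.

Lemma norm_star_hom (A B : cstarAlgType R) (f : A -> B) : star_hom f ->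
  forall a, `|f a| <= `|a|.
Proof.
move=> hf.
have unitball x : x^# = x -> `|x| < 1 -> `|f x| <= 1.
  move=> xs x1; have [y [ys xy e]] := circle_completion xs x1.
  apply: (@norm_le1_of_circle _ _ _ (f y)); rewrite -?star_hom_star -?star_hom_mul //.
  - by rewrite xs.
  - by rewrite ys.
  - by rewrite xy.
  - by rewrite e star_homB // star_homD.
have scaled x (r : C) : x^# = x -> `|x| < r -> `|f x| <= r.
  move=> xs xr; have r0 : 0 < r by rewrite (le_lt_trans _ xr).
  have rv : Num.conj r^-1 = r^-1 by rewrite fmorphV; congr (_^-1); apply: conj_Creal; exact: gtr0_real.
  have := @unitball (r^-1 *: x).
  rewrite cstarZ rv xs star_homZ // !normrZ normfV gtr0_norm // => /(_ erefl).
  by rewrite mulrC ltr_pdivrMr // mul1r => /(_ xr); rewrite mulrC ler_pdivrMr // mul1r.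
have selfadj x : x^# = x -> `|f x| <= `|x|.
  move=> xs; apply/ler_addgt0Pl => e e0; apply: scaled => //.
  by rewrite ltrDr.
move=> a; rewrite -ler_sqr ?nnegrE // -!cnorm_star -star_hom_star // -star_hom_mul //.
by apply: selfadj; rewrite cstarM cstarK.
Qed.

End Contractive.

Section ClosedLine.
Variables (R : realType) (V : completeNormedModType R[i]).
Local Notation C := R[i].

Lemma realseq_limit (u : nat -> R) : (forall n m, (n <= m)%N -> `|u n - u m| <= 2 / n.+1%:R) ->
  exists l, forall eps : R, 0 < eps -> exists N, forall n, (N <= n)%N -> `|l - u n| < eps.
Proof.
move=> hu.
have : cvgn u.
  apply/cauchy_cvgP/cauchy_exP => eps e0.
  have [N _ hN] := near_infty_natSinv_lt (PosNum (divr_gt0 e0 (ltr0n R 2))).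
  exists (u N); exists N => // n /= Nn.
  rewrite -ball_normE /=; apply: le_lt_trans (hu _ _ Nn) _.
  by have := hN N (leqnn N); rewrite /= ltr_pdivlMr // mulrC.
move=> /cvg_ex[l ul]; exists l => eps e0.
by move/cvgrPdist_lt : ul => /(_ _ e0) [N _ hN]; exists N => n /hN.
Qed.

Lemma normc_ge_Im (z : C) : (`|complex.Im z|%:C)%C <= `|z|.
Proof. by rewrite normc_def lecR -sqrtr_sqr ler_wsqrtr // lerDr sqr_ge0. Qed.

Lemma normc_le_ReIm (z : C) : `|z| <= ((`|complex.Re z| + `|complex.Im z|)%:C)%C.
Proof.
have s0 : 0 <= `|complex.Re z| + `|complex.Im z| by rewrite addr_ge0.
rewrite normc_def lecR -[leRHS](ger0_norm s0) -sqrtr_sqr ler_wsqrtr //.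
rewrite sqrrD !real_normK ?num_real //.
by rewrite addrAC lerDl mulrn_wge0 // mulr_ge0.
Qed.

Lemma closed_line (p : V) : closed [set b | exists c : C, b = c *: p].
Proof.
apply: closed_of_approx => b hb.
have [p0|p0] := eqVneq p 0.
  exists 0; rewrite scale0r; apply: (@norm_eps_eq0 _ _ _ 1) => // e e0.
  have [_ [c ->]] := hb e e0.
  by rewrite p0 scaler0 subr0 mul1r => /ltW.
have pp : 0 < `|p| by rewrite normr_gt0.
have /choice[c hc] : forall n : nat, exists c : C, `|b - c *: p| < `|p| * (n.+1%:R)^-1.
  move=> n; have [|_ [c ->] ?] := hb (`|p| * (n.+1%:R)^-1); last by exists c.
  by rewrite mulr_gt0 // invr_gt0 ltr0n.
have dc n m : (n <= m)%N -> `|c n - c m| <= ((2 / n.+1%:R)%:C)%C.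
  move=> nm; rewrite -(ler_pM2r pp) -normrZ scalerBl.
  rewrite -(subrKA b) addrC (le_trans (ler_normD _ _)) //.
  have -> : ((2 / n.+1%:R)%:C)%C = (n.+1%:R)^-1 + (n.+1%:R)^-1 :> C.
    by rewrite rmorphM fmorphV !rmorph_nat mulr_natl mulr2n.
  rewrite mulrDl lerD //; last by rewrite distrC mulrC ltW.
  rewrite (le_trans (ltW (hc m))) // mulrC ler_pM2r //.
  by rewrite lef_pV2 ?posrE ?ltr0n // ler_nat.
have [x hx] : exists l, forall eps : R, 0 < eps -> exists N, forall n, (N <= n)%N -> `|l - complex.Re (c n)| < eps.
  apply: realseq_limit => n m /dc; rewrite -lecR; apply: le_trans.
  by apply: le_trans (normc_ge_Re (c n - c m)); rewrite raddfB.
have [y hy] : exists l, forall eps : R, 0 < eps -> exists N, forall n, (N <= n)%N -> `|l - complex.Im (c n)| < eps.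
  apply: realseq_limit => n m /dc; rewrite -lecR; apply: le_trans.
  by apply: le_trans (normc_ge_Im (c n - c m)); rewrite raddfB.
exists (x +i* y)%C; apply/eqP; rewrite -subr_eq0; apply/eqP.
apply: (@norm_eps_eq0 _ _ _ (`|p| * 3)) => [|eps e0]; first by rewrite mulr_ge0.
have eE : eps = ((complex.Re eps)%:C)%C by rewrite RRe_real // gtr0_real.
have e0' : 0 < complex.Re eps by move: e0; rewrite ltcE => /andP[].
have [N1 h1] := hx _ e0'; have [N2 h2] := hy _ e0'.
have [N3 _ h3] := near_infty_natSinv_lt (PosNum e0').
pose N := maxn N1 (maxn N2 N3).
have n1 : (N1 <= N)%N by rewrite leq_maxl.
have n2 : (N2 <= N)%N by rewrite /N maxnCA leq_maxl.
have n3 : (N3 <= N)%N by rewrite /N maxnA leq_maxr.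
rewrite -(subrKA (c N *: p)) (le_trans (ler_normD _ _)) // -scalerBl normrZ.
have -> : `|p| * 3 * eps = `|p| * eps + (eps + eps) * `|p| by ring.
rewrite lerD //.
  rewrite (le_trans (ltW (hc N))) // ler_pM2l // eE.
  have := h3 _ n3; rewrite /= -ltcR => /ltW; rewrite fmorphV rmorph_nat; exact.
rewrite ler_pM2r // (le_trans (normc_le_ReIm _)) // eE -rmorphD lecR.
by rewrite lerD // !raddfB /= distrC ltW // ?h1 ?h2.
Qed.

End ClosedLine.

Section Frame.
Variable R : realType.
Local Notation C := R[i].

Lemma csa_preimage (A B : cstarAlgType R) (f : A -> B) (S : set B) : star_hom f ->
  closed_star_subalgebra S -> closed_star_subalgebra (f @^-1` S).
Proof.
move=> hf [cS S0 Sl Sm Ss]; split => /=.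
- apply: (@lipschitz_closed_preimage _ _ _ _ 1) => // a b.
  by rewrite mul1r -star_homB // norm_star_hom.
- by rewrite star_hom0.
- by move=> k a b Sa Sb; rewrite (star_hom_linear hf); exact: Sl.
- by move=> a b Sa Sb; rewrite (star_hom_mul hf); exact: Sm.
- by move=> a Sa; rewrite (star_hom_star hf); exact: Ss.
Qed.

Lemma closed_mul_line (A : cstarAlgType R) (x y p : A) :
  closed [set b | exists c : C, x ** b ** y = c *: p].
Proof.
apply: (@lipschitz_closed_preimage _ _ _ (fun b => x ** b ** y) (`|x| * `|y|) _ _ (closed_line (p := p))).
move=> a b; rewrite -cmulBl -cmulBr (le_trans (cnormM _ _)) // mulrAC ler_wpM2r //.
exact: cnormM.
Qed.

Lemma closed_mul_eq (A : cstarAlgType R) (x y : A) :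
  closed [set b | x ** b ** y = b ** y].
Proof.
have -> : [set b | x ** b ** y = b ** y] =
    (fun b => x ** b ** y - b ** y) @^-1` [set b | exists c : C, b = c *: (0 : A)].
  apply/seteqP; split => b /=; first by move=> ->; exists 0; rewrite subrr scaler0.
  by move=> [c]; rewrite scaler0 => /eqP; rewrite subr_eq0 => /eqP.
apply: (@lipschitz_closed_preimage _ _ _ _ ((`|x| + 1) * `|y|) _ _ (closed_line (p := 0))).
move=> a b.
have -> : x ** a ** y - a ** y - (x ** b ** y - b ** y) = x ** (a - b) ** y - (a - b) ** y.
  by rewrite cmulBr !cmulBl !opprB addrACA [RHS]addrACA [X in _ = _ + X]addrC.
rewrite (le_trans (ler_normB _ _)) // mulrAC mulrDl mul1r mulrDl lerD //.
  by rewrite (le_trans (cnormM _ _)) // ler_wpM2r // cnormM.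
exact: cnormM.
Qed.

Record frame (A : cstarAlgType R) (p : A) (n : nat) (g : 'I_n -> A) : Prop := {
  frame_selfadjoint : p^# = p;
  frame_orth : forall i j, i != j -> (g i)^# ** g j = 0;
  frame_norm : forall i, g i = 0 \/ (g i)^# ** g i = p;
  frame_id : forall i, g i ** p = g i
}.

Definition frame_projection (A : cstarAlgType R) n (g : 'I_n -> A) : A :=
  \sum_i g i ** (g i)^#.

Definition frame_algebra (A : cstarAlgType R) (p : A) n (g : 'I_n -> A) : set A :=
  [set b | [/\ forall i j, exists c : C, (g i)^# ** b ** g j = c *: p,
    forall j, frame_projection g ** b ** g j = b ** g j &
    forall j, frame_projection g ** b^# ** g j = b^# ** g j]].

Section FrameTheory.
Variables (A : cstarAlgType R) (p : A) (n : nat) (g : 'I_n -> A).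
Hypothesis gF : frame p g.
Local Notation K := (frame_projection g).

Lemma frame_pp : (exists i, g i <> 0) -> p ** p = p.
Proof.
by case=> i; case: (frame_norm gF i) => // h _; rewrite -{1}h -cmulA (frame_id gF).
Qed.

Lemma frame_projectionK j : K ** g j = g j.
Proof.
rewrite /frame_projection cmul_suml (bigD1 j) //= big1 => [|i ij].
  rewrite addr0 -cmulA; case: (frame_norm gF j) => ->; first by rewrite cmul0a.
  exact: (frame_id gF).
by rewrite -cmulA (frame_orth gF) // cmula0.
Qed.

Lemma frame_mul_split b b' i j : K ** b' ** g j = b' ** g j ->
  (g i)^# ** (b ** b') ** g j =
  \sum_k ((g i)^# ** b ** g k) ** ((g k)^# ** b' ** g j).
Proof.
move=> h; rewrite -!cmulA -h /frame_projection -!cmulA cmul_suml !cmul_sumr.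
by apply: eq_bigr => k _; rewrite !cmulA.
Qed.

Lemma csa_frame_algebra : closed_star_subalgebra (frame_algebra p g).
Proof.
split.
- have -> : frame_algebra p g =
      \bigcap_(ij in setT) [set b | exists c : C, (g ij.1)^# ** b ** g ij.2 = c *: p] `&`
      \bigcap_(j in setT) ([set b | K ** b ** g j = b ** g j] `&`
        cstar @^-1` [set b | K ** b ** g j = b ** g j]).
    apply/seteqP; split => b.
      by case=> h1 h2 h3; split => [[i j] _|j _]; [exact: h1|split; [exact: h2|exact: h3]].
    move=> [h1 h2]; split => [i j|j|j]; first exact: (h1 (i, j) I).
      by case: (h2 j I).
    by case: (h2 j I).
  apply: closedI; apply: closed_bigI => j _; first exact: closed_mul_line.
  apply: closedI; first exact: closed_mul_eq.
  apply: (@lipschitz_closed_preimage _ _ _ _ 1 _ _ (@closed_mul_eq _ _ _)) => a b.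
  by rewrite mul1r -cstarB norm_cstar.
- split => [i j|j|j]; last 2 first.
  + by rewrite cmula0 !cmul0a.
  + by rewrite cstar0 cmula0 !cmul0a.
  by exists 0; rewrite scale0r cmula0 cmul0a.
- move=> k a b [a1 a2 a3] [b1 b2 b3]; split => [i j|j|j].
  + have [c hc] := a1 i j; have [c' hc'] := b1 i j.
    exists (k * c + c').
    by rewrite cmulDr cmulDl cmulZr cmulZl hc hc' scalerA -scalerDl.
  + by rewrite cmulDr !cmulDl cmulZr !cmulZl a2 b2.
  + by rewrite cstarD cstarZ cmulDr !cmulDl cmulZr !cmulZl a3 b3.
- have mulK b b' j : (forall j, K ** b ** g j = b ** g j) ->
    K ** b' ** g j = b' ** g j -> K ** (b ** b') ** g j = b ** b' ** g j.
    move=> h h'; have E : b' ** g j = \sum_k g k ** ((g k)^# ** (b' ** g j)).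
      rewrite -{1}h' -cmulA /frame_projection cmul_suml.
      by apply: eq_bigr => k _; rewrite -cmulA.
    rewrite cmulA -[in LHS]cmulA -[in RHS]cmulA E !cmul_sumr.
    by apply: eq_bigr => k _; rewrite cmulA h -cmulA.
  move=> b b' [b1 b2 b3] [b1' b2' b3']; split => [i j|j|j].
  + rewrite frame_mul_split //.
    have /choice[c hc] : forall k, exists c : C,
        ((g i)^# ** b ** g k) ** ((g k)^# ** b' ** g j) = c *: p.
      move=> k; have [c hc] := b1 i k; have [c' hc'] := b1' k j.
      rewrite hc hc' cmulZl cmulZr scalerA.
      case: (pselect (exists i, g i <> 0)) => [/frame_pp ->|h]; first by exists (c * c').
      suff g0 : g i = 0.
        by exists 0; rewrite -scalerA -cmulZr -cmulZl -hc g0 cstar0 !cmul0a scale0r.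
      by apply: contrapT => gi; apply: h; exists i.
    by exists (\sum_k c k); rewrite scaler_suml; apply: eq_bigr => k _; rewrite hc.
  + exact: mulK.
  + by rewrite cstarM; exact: mulK.
- move=> b [b1 b2 b3]; split => // [i j|j]; last by rewrite cstarK.
  have [c hc] := b1 j i; exists (Num.conj c).
  by rewrite -(frame_selfadjoint gF) -cstarZ -hc !cstarM cstarK cmulA.
Qed.

Lemma frame_algebra_mem b : (forall j, exists k (c : C), b ** g j = c *: g k) ->
  (forall j, exists k (c : C), b^# ** g j = c *: g k) -> frame_algebra p g b.
Proof.
move=> h h'; split => [i j|j|j].
- have [k [c hc]] := h j; rewrite -cmulA hc cmulZr.
  have [->|ik] := eqVneq i k; last by exists 0; rewrite (frame_orth gF) // scaler0 scale0r.
  case: (frame_norm gF k) => ->; last by exists c.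
  by exists 0; rewrite cmula0 scaler0 scale0r.
- by have [k [c hc]] := h j; rewrite -cmulA hc cmulZr frame_projectionK.
- by have [k [c hc]] := h' j; rewrite -cmulA hc cmulZr frame_projectionK.
Qed.

(* rho is read off from (g i)^* (f b) (g j) = (rho b) i j *: p. *)
Lemma frame_representation (B : cstarAlgType R) (f : B -> A) : star_hom f ->
  (forall b, frame_algebra p g (f b)) ->
  exists rho : B -> 'M[C]_n, matrix_representation rho /\
    forall b, rho b = 0 -> forall j, f b ** g j = 0.
Proof.
move=> hf hb.
case: (pselect (exists i, g i <> 0)) => [gn0|h]; last first.
  exists (fun=> 0); split; first split => [k a b|a b|a].
  - by rewrite scaler0 addr0.
  - by rewrite mulmx0.
  - by rewrite trmx0 map_mx0.
  move=> b _ j; have -> : g j = 0 by apply: contrapT => gi; apply: h; exists j.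
  by rewrite cmula0.
have p0 : p != 0.
  case: gn0 => i; case: (frame_norm gF i) => // h gi; apply/eqP => p0; apply: gi.
  by apply: cstar_mul_eq0; rewrite h.
have pp := frame_pp gn0.
have pI (c c' : C) : c *: p = c' *: p -> c = c'.
  by move=> /eqP; rewrite -subr_eq0 -scalerBl scaler_eq0 (negbTE p0) orbF subr_eq0 => /eqP.
have /choice[rho hr] : forall b, exists M : 'M[C]_n,
    forall i j, (g i)^# ** f b ** g j = M i j *: p.
  move=> b; have [h _ _] := hb b.
  have /choice[M hM] : forall ij : 'I_n * 'I_n, exists c : C,
    (g ij.1)^# ** f b ** g ij.2 = c *: p by move=> [i j]; exact: h.
  by exists (\matrix_(i, j) M (i, j)) => i j; rewrite mxE -hM.
exists rho; split.
  split => [k a b|a b|a]; apply/matrixP => i j; apply: pI; rewrite -hr !mxE.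
  - rewrite (star_hom_linear hf) cmulDr cmulDl cmulZr cmulZl !hr.
    by rewrite scalerA -scalerDl.
  - have [_ h _] := hb b.
    rewrite (star_hom_mul hf) frame_mul_split // scaler_suml; apply: eq_bigr => k _.
    by rewrite !hr cmulZl cmulZr pp scalerA.
  - rewrite (star_hom_star hf) -[in RHS](frame_selfadjoint gF) -cstarZ -hr !cstarM cstarK.
    by rewrite cmulA.
move=> b r0 j; have [_ <- _] := hb b.
rewrite /frame_projection -cmulA cmul_suml big1 // => i _.
by rewrite -cmulA (cmulA (g i)^#) hr r0 mxE scale0r cmula0.
Qed.

End FrameTheory.
End Frame.

Section FinsetGraphFunctions.
Variables (R : realType) (X : choiceType).
Local Notation C := R[i].
Local Notation E := (finset_graph X).
Local Notation V := {fset X}.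
Local Notation W := (finset_edge X).
Implicit Types (f g : V -> C) (xi eta : W -> C) (v w : V) (e : W).

Definition edges_over (s : seq V) : {fset W} :=
  [fset e in pmap insub [seq (x, w) | w <- s, x <- enum_fset w]]%fset.

Lemma in_edges_over s e : (e \in edges_over s) = ((val e).2 \in s).
Proof.
rewrite !inE mem_pmap_sub; apply/allpairsPdep/idP => [[w [x [ws xw ->]]] //|es].
by exists (val e).2, (val e).1; split => //; [exact: (valP e)|case: (val e)].
Qed.

Lemma compact_discrete (T : choiceType) (K : set (discrete_topology T)) : compact K ->
  exists F : {fset T}, forall x, K x -> x \in F.
Proof.
move=> cK; apply: contrapT => h.
have infK : ~ finite_set K.
  by move=> /(@finite_fsetP T)[F KF]; apply: h; exists F => x; rewrite KF.
pose F : set_system (discrete_topology T) := fun B => finite_set (K `\` B).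
have PF : ProperFilter F.
  apply: Build_ProperFilter_ex => [B FB|].
    apply: contrapT => B0; apply: infK; apply: sub_finite_set FB => x Kx.
    by split => // Bx; apply: B0; exists x.
  split => [|P Q FP FQ|P Q PQ].
  - by rewrite /F setDT.
  - by rewrite /F setDIr finite_setU.
  - by apply: sub_finite_set => x [Kx nQ]; split => // /PQ.
have FK : F K by rewrite /F setDv.
have [p [Kp]] := cK F PF FK.
have Fp : F (~` [set p]).
  by apply: (sub_finite_set _ (finite_set1 p)) => x [_ /contrapT].
by move=> /(_ _ _ Fp (discrete_set1 p)) [x [/=]].
Qed.

Lemma C0P f : @C0 R E f <-> forall eps : C, 0 < eps ->
  exists F : {fset V}, forall v, v \notin F -> `|f v| < eps.
Proof.
split=> [[_ h] eps e0|h].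
  have [K /compact_discrete[F KF] hK] := h eps e0.
  by exists F => v vF; apply: hK => /KF; apply/negP.
split; first exact: discrete_continuous.
move=> eps e0; have [F hF] := h eps e0; exists [set` F].
  exact: (@finite_compact (discrete_topology V) _ (finite_fset F)).
by move=> v /negP; exact: hF.
Qed.

Lemma C0_finite_support (F : {fset V}) f : (forall v, v \notin F -> f v = 0) -> @C0 R E f.
Proof.
by move=> h; apply/C0P => eps e0; exists F => v /h ->; rewrite normr0.
Qed.

Lemma C0_dominated f g : @C0 R E f -> (forall v, `|g v| <= `|f v|) -> @C0 R E g.
Proof.
move=> /C0P h gf; apply/C0P => eps e0; have [F hF] := h eps e0.
by exists F => v /hF; exact: le_lt_trans.
Qed.

Lemma C0_mul f g : @C0 R E f -> @C0 R E g -> @C0 R E (fun v => f v * g v).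
Proof.
move=> /C0P hf /C0P hg; apply/C0P => eps e0.
have [F hF] := hf eps e0; have [G hG] := hg 1 ltr01.
exists (F `|` G)%fset => v; rewrite inE negb_or => /andP[/hF fe /hG g1].
rewrite normrM; have [->|g0] := eqVneq (g v) 0; first by rewrite normr0 mulr0.
rewrite -[ltRHS]mulr1 (@lt_le_trans _ _ (eps * `|g v|)) //.
  by rewrite ltr_pM2r // normr_gt0.
by rewrite ler_pM2l // ltW.
Qed.

Lemma C0_linear (k : C) f g : @C0 R E f -> @C0 R E g -> @C0 R E (k *: f + g).
Proof.
move=> /C0P hf /C0P hg; apply/C0P => eps e0.
have e2 : 0 < eps / 2 by rewrite divr_gt0.
have e1 : 0 < (eps / 2) / (`|k| + 1) by rewrite divr_gt0 // ltr_wpDl.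
have [F hF] := hf _ e1; have [G hG] := hg _ e2.
exists (F `|` G)%fset => v; rewrite inE negb_or => /andP[/hF fe /hG ge].
rewrite /= (le_lt_trans (ler_normD _ _)) // [ltRHS]splitr ler_ltD //.
rewrite normrM (@le_trans _ _ ((`|k| + 1) * `|f v|)) //.
  by rewrite ler_wpM2r // lerDl.
by rewrite mulrC -ler_pdivlMr ?ltr_wpDl // ltW.
Qed.

Lemma sum_finite_support (x : W -> C) (D : set W) (F : {fset W}) :
  (forall e, D e -> e \in F) -> (forall e, e \in F -> D e) ->
  summability.sum (x \_ D) = \sum_(e <- F) x e.
Proof.
move=> DF FD; rewrite /summability.sum.
have TF := @summability.totally_filter W.
apply: (lim_near_cst (@norm_hausdorff _ _)).
exists F => // B /= FB.
rewrite /summability.partial_sum -(big_seq_fsetE _ _ predT) /=.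
rewrite -(big_fset_incl _ FB) => [|e _ eF].
  by rewrite big_seq [RHS]big_seq; apply: eq_bigr => e /FD eD; rewrite patchT // inE.
by rewrite patchN //; apply/negP; rewrite inE => /DF; apply/negP.
Qed.

Lemma innerE xi eta v : @inner R E xi eta v =
  \sum_(e <- edges_over [:: v]) Num.conj (xi e) * eta e.
Proof.
rewrite /inner (@sum_finite_support _ _ (edges_over [:: v])) // => e /=.
  by rewrite in_edges_over inE => ->.
by rewrite in_edges_over inE => /eqP.
Qed.

Lemma CdP xi : @C0 R E (@inner R E xi xi) -> @Cd R E xi.
Proof.
move=> h; split => //; first exact: discrete_continuous.
move=> v; rewrite esum_fset => [||e _]; last by rewrite lee_fin -ler0c RRe_real ?ger0_real // exprn_ge0.
  rewrite fsbig_finite /=; first by apply: lte_sum_pinfty => e _; rewrite ltry.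
  by apply: (@sub_finite_set _ _ [set` edges_over [:: v]]) => // e /=; rewrite in_edges_over inE => ->.
by apply: (@sub_finite_set _ _ [set` edges_over [:: v]]) => // e /=; rewrite in_edges_over inE => ->.
Qed.

Lemma Cd_inner xi : @Cd R E xi -> @C0 R E (@inner R E xi xi).
Proof. by case. Qed.

Definition cutoff (T : Type) (P : pred T) (f : T -> C) : T -> C :=
  fun x => if P x then f x else 0.

Lemma cutoff_linear (T : Type) (P : pred T) (k : C) (f g : T -> C) :
  cutoff P (k *: f + g) = k *: cutoff P f + cutoff P g.
Proof.
by apply/funext => x; rewrite /cutoff !fctE; case: ifP; rewrite // scaler0 addr0.
Qed.

Lemma inner_cutoff (P Q : pred V) xi eta :
  @inner R E (cutoff (fun e => P (val e).2) xi) (cutoff (fun e => Q (val e).2) eta) =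
  cutoff (fun v => P v && Q v) (@inner R E xi eta).
Proof.
apply/funext => v; rewrite /cutoff !innerE; case: ifPn => [/andP[Pv Qv]|h].
  rewrite big_seq [RHS]big_seq; apply: eq_bigr => e.
  by rewrite in_edges_over inE => /eqP ->; rewrite Pv Qv.
rewrite big_seq big1 // => e; rewrite in_edges_over inE => /eqP ->.
by move: h; case: (P v); case: (Q v) => // _; rewrite ?rmorph0 ?mulr0 ?mul0r.
Qed.

Lemma C0_cutoff (P : pred V) f : @C0 R E f -> @C0 R E (cutoff P f).
Proof.
by move=> h; apply: C0_dominated h _ => v; rewrite /cutoff; case: ifP; rewrite ?normr0.
Qed.

Lemma Cd_cutoff (P : pred V) xi : @Cd R E xi -> @Cd R E (cutoff (fun e => P (val e).2) xi).
Proof.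
move=> h; apply: CdP; rewrite inner_cutoff; exact/C0_cutoff/Cd_inner.
Qed.

Lemma Cd_finite_support (F : {fset V}) xi :
  (forall e, (val e).2 \notin F -> xi e = 0) -> @Cd R E xi.
Proof.
move=> h; apply: CdP; apply: (@C0_finite_support F) => v vF.
rewrite innerE big_seq big1 // => e; rewrite in_edges_over inE => /eqP ev.
by rewrite h ?mulr0 // ev.
Qed.

Definition delta_vertex v : V -> C := fun w => (w == v)%:R.
Definition delta_edge (q : X * V) : W -> C := fun e => (val e == q)%:R.

Lemma C0_delta v : @C0 R E (delta_vertex v).
Proof.
apply: (@C0_finite_support [fset v]%fset) => w; rewrite inE /delta_vertex => /negbTE -> //.
Qed.

Lemma Cd_delta q : @Cd R E (delta_edge q).
Proof.
apply: (@Cd_finite_support [fset q.2]%fset) => e; rewrite inE /delta_edge => h.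
by case: eqP => // eq; rewrite eq eqxx in h.
Qed.

Lemma inner_delta e xi :
  @inner R E (delta_edge (val e)) xi = xi e *: delta_vertex (val e).2.
Proof.
apply/funext => v; rewrite innerE /delta_vertex fctE /=.
have [->|ve] := eqVneq v (val e).2.
  rewrite (bigD1_seq e) ?fset_uniq ?in_edges_over ?inE //= big1 => [|e' e'e].
    by rewrite addr0 /delta_edge eqxx rmorph1 mul1r [RHS]mulr1.
  by rewrite /delta_edge (inj_eq val_inj) (negbTE e'e) rmorph0 mul0r.
rewrite [RHS]mulr0 big_seq big1 // => e'; rewrite in_edges_over inE => /eqP e'v.
rewrite /delta_edge; case: eqP => [ee|_]; last by rewrite rmorph0 mul0r.
by move: ve; rewrite -e'v ee eqxx.
Qed.

Lemma inner_scale_right (h : V -> C) xi eta :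
  @inner R E xi (fun e => eta e * h (val e).2) = fun v => @inner R E xi eta v * h v.
Proof.
apply/funext => v; rewrite !innerE mulr_suml big_seq [RHS]big_seq.
by apply: eq_bigr => e; rewrite in_edges_over inE mulrA => /eqP ->.
Qed.

Lemma inner_conj xi eta v : @inner R E xi eta v = Num.conj (@inner R E eta xi v).
Proof.
rewrite !innerE rmorph_sum; apply: eq_bigr => e _ /=.
by rewrite rmorphM /= conjCK mulrC.
Qed.

Lemma C0_conj f : @C0 R E f -> @C0 R E (fun v => Num.conj (f v)).
Proof. by move=> h; apply: C0_dominated h _ => v; rewrite norm_conjC. Qed.

Lemma Cd_scale_right (h : V -> C) xi : @C0 R E h -> @Cd R E xi ->
  @Cd R E (fun e => xi e * h (val e).2).
Proof.
move=> hC xC; apply: CdP; rewrite inner_scale_right.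
have -> : @inner R E (fun e => xi e * h (val e).2) xi =
    fun v => @inner R E xi xi v * Num.conj (h v).
  apply/funext => v; rewrite inner_conj inner_scale_right rmorphM /= -inner_conj //.
exact: (C0_mul (C0_mul (Cd_inner xC) (C0_conj hC)) hC).
Qed.

End FinsetGraphFunctions.

Section ToeplitzPair.
Variables (R : realType) (X : choiceType) (A : cstarAlgType R).
Local Notation C := R[i].
Local Notation E := (finset_graph X).
Local Notation V := {fset X}.
Local Notation W := (finset_edge X).
Variables (t0 : (V -> C) -> A) (t1 : (W -> C) -> A).
Hypothesis HT : @toeplitz_pair R E A t0 t1.
Implicit Types (f g : V -> C) (xi eta : W -> C) (v w : V) (e : W) (q : X * V).

Definition tv v : A := t0 (delta_vertex R v).
Definition te q : A := t1 (delta_edge R q).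

Lemma t0_zero : t0 (fun=> 0) = 0.
Proof.
have C00 : @C0 R E (fun=> 0) by apply: (@C0_finite_support _ _ fset0).
have := toeplitz_linear0 HT (-1) C00 C00.
rewrite [X in _ = X + _]scaleN1r [X in _ = X]addNr => <-; congr (t0 _); apply/funext => v.
by rewrite !fctE /= addr0 scaler0.
Qed.

Lemma t1_zero : t1 (fun=> 0) = 0.
Proof.
have C00 : @Cd R E (fun=> 0) by apply: (@Cd_finite_support _ _ fset0).
have := toeplitz_linear1 HT (-1) C00 C00.
rewrite [X in _ = X + _]scaleN1r [X in _ = X]addNr => <-; congr (t1 _); apply/funext => v.
by rewrite !fctE /= addr0 scaler0.
Qed.

Lemma t0Z (k : C) f : @C0 R E f -> t0 (k *: f) = k *: t0 f.
Proof.
move=> fC; have C00 : @C0 R E (fun=> 0) by apply: (@C0_finite_support _ _ fset0).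
have := toeplitz_linear0 HT k fC C00; rewrite t0_zero [X in _ = X]addr0 => <-.
by congr (t0 _); apply/funext => v; rewrite !fctE addr0.
Qed.

Lemma t0B f g : @C0 R E f -> @C0 R E g -> t0 (f - g) = t0 f - t0 g.
Proof.
move=> fC gC; rewrite addrC -[- g]scaleN1r (toeplitz_linear0 HT) //.
by rewrite scaleN1r addrC.
Qed.

Lemma t1B xi eta : @Cd R E xi -> @Cd R E eta -> t1 (xi - eta) = t1 xi - t1 eta.
Proof.
move=> fC gC; rewrite addrC -[- eta]scaleN1r (toeplitz_linear1 HT) //.
by rewrite scaleN1r addrC.
Qed.

Lemma t1_mul_t0 xi f : @Cd R E xi -> @C0 R E f ->
  t1 xi ** t0 f = t1 (fun e => xi e * f (val e).2).
Proof.
move=> xC fC; have xfC := Cd_scale_right fC xC.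
have fcC := C0_conj fC; have iC := Cd_inner xC.
have e1 : @inner R E (fun e => xi e * f (val e).2) xi =
    fun v => Num.conj (f v) * @inner R E xi xi v.
  by apply/funext => v; rewrite inner_conj inner_scale_right rmorphM /= -inner_conj mulrC.
have e2 : @inner R E (fun e => xi e * f (val e).2) (fun e => xi e * f (val e).2) =
    fun v => Num.conj (f v) * @inner R E xi xi v * f v.
  by rewrite inner_scale_right e1.
have C1 := C0_mul fcC iC; have C2 := C0_mul iC fC.
apply/eqP; rewrite -subr_eq0; apply/eqP/cstar_mul_eq0.
rewrite cstarB cstarM -(toeplitz_star0 HT) // cmulBl !cmulBr.
rewrite !cmulA -(cmulA (t0 _) (t1 xi)^# (t1 xi)) -(cmulA (t0 _) (t1 xi)^#) !(toeplitz_inner HT) //.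
rewrite e2 e1 inner_scale_right -!(toeplitz_mul0 HT) //.
rewrite [X in _ - X - _](_ : _ = t0 (fun v => Num.conj (f v) * @inner R E xi xi v * f v)).
  by rewrite subrr.
by congr (t0 _); apply/funext => v; rewrite mulrA.
Qed.

Lemma tv_star v : (tv v)^# = tv v.
Proof.
rewrite /tv -(toeplitz_star0 HT); last exact: C0_delta.
by congr (t0 _); apply/funext => w; rewrite /delta_vertex rmorph_nat.
Qed.

Lemma tv_t0 v f : @C0 R E f -> tv v ** t0 f = f v *: tv v.
Proof.
move=> fC; rewrite /tv -(toeplitz_mul0 HT) -?t0Z //; try exact: C0_delta.
congr (t0 _); apply/funext => w; rewrite !fctE /delta_vertex /=.
by case: eqP => [->|_]; [rewrite mul1r [RHS]mulr1|rewrite mul0r scaler0].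
Qed.

Lemma tv_mul v w : tv v ** tv w = (v == w)%:R *: tv v.
Proof. by rewrite tv_t0 //; exact: C0_delta. Qed.

Lemma te_tv q v : te q ** tv v = (q.2 == v)%:R *: te q.
Proof.
rewrite t1_mul_t0; [|exact: Cd_delta|exact: C0_delta].
have [qv|qv] := eqVneq q.2 v.
  rewrite scale1r; congr (t1 _); apply/funext => e; rewrite /delta_edge /delta_vertex.
  by case: eqP => [->|_]; rewrite ?mul0r // qv eqxx mulr1.
rewrite scale0r -t1_zero; congr (t1 _); apply/funext => e; rewrite /delta_edge /delta_vertex.
by case: eqP => [->|_]; rewrite ?mul0r // (negbTE qv) mulr0.
Qed.

Lemma tv_te q v : tv v ** te q = (v == (q.2 `\ q.1)%fset)%:R *: te q.
Proof.
rewrite (toeplitz_left HT); [|exact: C0_delta|exact: Cd_delta].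
have [->|qv] := eqVneq v (q.2 `\ q.1)%fset.
  rewrite scale1r; congr (t1 _); apply/funext => e.
  rewrite /left_action /delta_edge /delta_vertex /=.
  by have [->|_] := eqVneq (val e) q; rewrite ?mulr0 // eqxx mulr1.
rewrite scale0r -t1_zero; congr (t1 _); apply/funext => e.
rewrite /left_action /delta_edge /delta_vertex /=.
by have [->|_] := eqVneq (val e) q; rewrite ?mulr0 // eq_sym (negbTE qv) mul0r.
Qed.

Lemma te_star_t1 e xi : @Cd R E xi -> (te (val e))^# ** t1 xi = xi e *: tv (val e).2.
Proof.
move=> xC; rewrite (toeplitz_inner HT) //; last exact: Cd_delta.
by rewrite inner_delta t0Z //; exact: C0_delta.
Qed.

Lemma te_out q : q.1 \notin q.2 -> te q = 0.
Proof.
move=> h; rewrite -t1_zero; congr (t1 _); apply/funext => e; rewrite /delta_edge.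
by case: eqP => // eq; move: h; rewrite -eq (valP e).
Qed.

Lemma te_star_te q q' : q.1 \in q.2 -> (te q)^# ** te q' = (q == q')%:R *: tv q.2.
Proof.
move=> h; rewrite (te_star_t1 (exist _ q h)) /=; first by rewrite /delta_edge.
exact: Cd_delta.
Qed.

Lemma te_te_star q q' : q.2 != q'.2 -> te q ** (te q')^# = 0.
Proof.
move=> h; have -> : te q = te q ** tv q.2 by rewrite te_tv eqxx scale1r.
rewrite -cmulA -[tv q.2]tv_star -cstarM te_tv eq_sym (negbTE h) scale0r.
by rewrite cstar0 cmula0.
Qed.

Lemma t1_finite_support (F : {fset W}) xi :
  t1 (cutoff (fun e => e \in F) xi) = \sum_(e <- F) xi e *: te (val e).
Proof.
suff H (s : seq W) : uniq s ->
    @Cd R E (cutoff (fun e => e \in s) xi) /\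
    t1 (cutoff (fun e => e \in s) xi) = \sum_(e <- s) xi e *: te (val e).
  by have [_] := H _ (fset_uniq F).
elim: s => [_|a s IH /= /andP[as_ /IH[IC IE]]].
  have -> : cutoff (fun e => e \in [::]) xi = fun=> 0 by apply/funext.
  by rewrite big_nil t1_zero; split => //; apply: (@Cd_finite_support _ _ fset0).
have -> : cutoff (fun e => e \in a :: s) xi =
    xi a *: delta_edge R (val a) + cutoff (fun e => e \in s) xi.
  apply/funext => e; rewrite !fctE /cutoff /delta_edge inE (inj_eq val_inj).
  have [->|ea] := eqVneq e a; last by rewrite /= scaler0 add0r.
  by rewrite /= (negbTE as_) addr0 [RHS]mulr1.
split; last by rewrite big_cons (toeplitz_linear1 HT) // ?IE //; exact: Cd_delta.
apply: (@Cd_finite_support _ _ [fset (val e).2 | e in a :: s]%fset) => e.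
move=> h; rewrite !fctE /cutoff /delta_edge (inj_eq val_inj).
have es : e \notin a :: s by apply: contra h => es; apply/imfsetP; exists e.
move: es; rewrite inE negb_or => /andP[/negbTE -> /negbTE ->].
by rewrite scaler0 addr0.
Qed.

Lemma t1_finite (s : seq V) xi : t1 (cutoff (fun e => (val e).2 \in s) xi) =
  \sum_(e <- edges_over s) xi e *: te (val e).
Proof.
rewrite -t1_finite_support; congr (t1 _); apply/funext => e.
by rewrite /cutoff in_edges_over.
Qed.

Lemma norm_t0_le1 f : @C0 R E f -> (forall v, Num.conj (f v) = f v) ->
  (forall v, `|f v| <= 1) -> `|t0 f| <= 1.
Proof.
move=> fC fr f1.
pose k v := 1 - sqrtC (1 - f v * f v).
have ff v : f v * f v = `|f v| ^+ 2 by rewrite normCK fr.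
have s0 v : 0 <= 1 - f v * f v by rewrite ff subr_ge0 expr_le1.
have q0 v : 0 <= sqrtC (1 - f v * f v) by rewrite sqrtC_ge0.
have q1 v : sqrtC (1 - f v * f v) <= 1.
  by rewrite -[X in _ <= X]sqrtC1 ler_sqrtC ?nnegrE ?ler01 // gerBl ff exprn_ge0.
have k0 v : 0 <= k v by rewrite subr_ge0.
have kk v : f v * f v = k v + k v - k v * k v.
  have : sqrtC (1 - f v * f v) ^+ 2 = 1 - f v * f v by rewrite sqrtCK.
  have -> : k v + k v - k v * k v = 1 - sqrtC (1 - f v * f v) ^+ 2 by rewrite /k; ring.
  by move=> ->; ring.
have kC : @C0 R E k.
  apply: C0_dominated fC _ => v; rewrite ger0_norm //.
  apply: (@le_trans _ _ (f v * f v)).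
    rewrite kk -addrA lerDl subr_ge0 ler_piMr // lerBlDr lerDl //.
  by rewrite ff expr2 ler_piMl.
apply: (@norm_le1_of_circle _ _ _ (t0 k)).
- by rewrite -(toeplitz_star0 HT) //; congr (t0 _); apply/funext.
- rewrite -(toeplitz_star0 HT) //; congr (t0 _); apply/funext => v.
  by apply: conj_Creal; exact: ger0_real.
- by rewrite -!(toeplitz_mul0 HT) //; congr (t0 _); apply/funext => v; rewrite mulrC.
- have kkC : @C0 R E (fun v => k v * k v) by exact: C0_mul.
  have kDC : @C0 R E (k + k) by rewrite -{1}[k]scale1r; exact: C0_linear.
  have <- : t0 (k + k) = t0 k + t0 k.
    by rewrite -{1}[k]scale1r (toeplitz_linear0 HT) // scale1r.
  rewrite -!(toeplitz_mul0 HT) // -t0B //; congr (t0 _); apply/funext => v.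
  by rewrite !fctE kk.
Qed.

Lemma norm_t0_le f (r : C) : 0 < r -> @C0 R E f -> (forall v, `|f v| <= r) -> `|t0 f| <= r.
Proof.
move=> r0 fC fr.
have gC : @C0 R E (fun v => Num.conj (f v) * f v) by apply: C0_mul => //; exact: C0_conj.
have cr : Num.conj r = r by apply: conj_Creal; exact: gtr0_real.
rewrite -ler_sqr ?nnegrE //; last exact: ltW.
rewrite -cnorm_star -(toeplitz_star0 HT) // -(toeplitz_mul0 HT) //; last exact: C0_conj.
have r20 : 0 < r ^- 2 by rewrite invr_gt0 exprn_gt0.
have := @norm_t0_le1 (r ^- 2 *: (fun v => Num.conj (f v) * f v)).
rewrite t0Z // normrZ gtr0_norm // ler_pdivrMl ?exprn_gt0 // mulr1; apply.
- rewrite -[X in C0 X]addr0; apply: C0_linear => //.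
  by apply: (@C0_finite_support _ _ fset0).
- move=> v; rewrite !fctE; rewrite !rmorphM /= conjCK.
  by rewrite fmorphV rmorphXn /= cr [f v * _]mulrC.
- move=> v; rewrite !fctE normrM gtr0_norm // ler_pdivrMl ?exprn_gt0 // mulr1.
  by rewrite normrM norm_conjC -expr2 lerXn2r ?nnegrE // ltW.
Qed.

End ToeplitzPair.

Section RestrictedPair.
Variables (R : realType) (X : choiceType) (A : cstarAlgType R).
Local Notation C := R[i].
Local Notation E := (finset_graph X).
Local Notation V := {fset X}.
Local Notation W := (finset_edge X).
Variables (t0 : (V -> C) -> A) (t1 : (W -> C) -> A).
Hypothesis HT : @toeplitz_pair R E A t0 t1.
Variable G : V.
Implicit Types (f g : V -> C) (xi eta : W -> C) (v w : V) (e : W) (q : X * V).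
Implicit Types (S : (W -> C) -> (W -> C)).
Local Notation te := (te t1).
Local Notation tv := (tv t0).

Definition subsets : seq V := enum_fset (fpowerset G).

Lemma in_subsets v : (v \in subsets) = (v `<=` G)%fset.
Proof. exact: fpowersetE. Qed.

Definition restricted0 f := t0 (cutoff (fun v => v \in subsets) f).
Definition restricted1 xi := t1 (cutoff (fun e => (val e).2 \in subsets) xi).

Lemma restricted1E xi : restricted1 xi = \sum_(e <- edges_over subsets) xi e *: te (val e).
Proof. exact: (t1_finite HT). Qed.

Lemma restricted_toeplitz : @toeplitz_pair R E A restricted0 restricted1.
Proof.
split.
- move=> k f g fC gC; rewrite /restricted0 cutoff_linear (toeplitz_linear0 HT) //; exact: C0_cutoff.
- move=> f g fC gC; rewrite -(toeplitz_mul0 HT); try exact: C0_cutoff.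
  by congr (t0 _); apply/funext => v; rewrite /cutoff; case: ifP; rewrite ?mulr0.
- move=> f fC; rewrite -(toeplitz_star0 HT); last exact: C0_cutoff.
  by congr (t0 _); apply/funext => v; rewrite /cutoff; case: ifP; rewrite ?rmorph0.
- move=> k xi eta xC eC; rewrite /restricted1 cutoff_linear (toeplitz_linear1 HT) //.
    exact: (Cd_cutoff (fun v => v \in subsets)).
  exact: (Cd_cutoff (fun v => v \in subsets)).
- move=> xi eta xC eC; rewrite (toeplitz_inner HT).
  + rewrite (inner_cutoff (fun v => v \in subsets) (fun v => v \in subsets)).
    by congr (t0 _); apply/funext => v; rewrite /cutoff andbb.
  + exact: (Cd_cutoff (fun v => v \in subsets)).
  + exact: (Cd_cutoff (fun v => v \in subsets)).
- move=> f xi fC xC; rewrite (toeplitz_left HT).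
  + congr (t1 _); apply/funext => e; rewrite /left_action /cutoff.
    have [h|_] := boolP ((val e).2 \in subsets); last by rewrite mulr0.
    have -> // : @ran E e \in subsets.
    by move: h; rewrite !in_subsets; apply: fsubset_trans; exact: fsubD1set.
  + exact: C0_cutoff.
  + exact: (Cd_cutoff (fun v => v \in subsets)).
Qed.

Definition op_entry S e e' : C := S (delta_edge R (val e')) e.

Definition restricted_Phi S : A :=
  \sum_(e <- edges_over subsets) \sum_(e' <- edges_over subsets)
    op_entry S e e' *: (te (val e) ** (te (val e'))^#).

Lemma op_entryE S S' zeta e : @is_adjoint R E S S' -> @Cd R E zeta ->
  S zeta e = \sum_(e' <- edges_over [:: (val e).2]) op_entry S e e' * zeta e'.
Proof.
move=> [SC S'C adj] zC.
have eval_ eta : @Cd R E eta -> S eta e =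
    \sum_(e' <- edges_over [:: (val e).2]) Num.conj (S' (delta_edge R (val e)) e') * eta e'.
  move=> eC; have := adj _ _ (@Cd_delta R X (val e)) eC.
  move=> /(congr1 (fun h => h (val e).2)); rewrite inner_delta fctE /delta_vertex eqxx.
  by rewrite innerE => <-; rewrite [RHS]mulr1.
rewrite eval_ // big_seq [RHS]big_seq; apply: eq_bigr => e' e'e; congr (_ * _).
rewrite /op_entry eval_; last exact: Cd_delta.
rewrite (bigD1_seq e') ?fset_uniq //= big1 => [|e'' ne].
  by rewrite addr0 /delta_edge eqxx mulr1.
by rewrite /delta_edge (inj_eq val_inj) (negbTE ne) mulr0.
Qed.

Lemma op_entry_diag S S' e e' : @is_adjoint R E S S' -> (val e).2 != (val e').2 ->
  op_entry S e e' = 0.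
Proof.
move=> adj ne; rewrite /op_entry (op_entryE _ adj); last exact: Cd_delta.
rewrite big_seq big1 // => e''; rewrite in_edges_over inE => /eqP h.
rewrite /delta_edge (inj_eq val_inj); case: eqP => [eq|_]; last by rewrite mulr0.
by move: ne; rewrite -eq h eqxx.
Qed.

Lemma op_entry_sum S S' zeta e : @is_adjoint R E S S' -> @Cd R E zeta ->
  (val e).2 \in subsets ->
  S zeta e = \sum_(e' <- edges_over subsets) op_entry S e e' * zeta e'.
Proof.
move=> adj zC es; rewrite (op_entryE _ adj) //; apply: big_fset_incl.
  by apply/fsubsetP => e'; rewrite !in_edges_over inE => /eqP ->.
move=> e' _; rewrite in_edges_over inE eq_sym => ne.
by rewrite (op_entry_diag adj) ?mul0r.
Qed.

Lemma is_adjoint_sym S S' : @is_adjoint R E S S' -> @is_adjoint R E S' S.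
Proof.
move=> [SC S'C H]; split => // xi eta xC eC; apply/funext => v.
by rewrite inner_conj -H // -inner_conj.
Qed.

Lemma adjoint_entry S S' e e' : @is_adjoint R E S S' ->
  op_entry S' e e' = Num.conj (op_entry S e' e).
Proof.
move=> adj; have [h|h] := eqVneq (val e').2 (val e).2; last first.
  rewrite (op_entry_diag adj h) rmorph0.
  by rewrite (op_entry_diag (is_adjoint_sym adj)) // eq_sym.
have [_ _ H] := adj.
have := H _ _ (@Cd_delta R X (val e')) (@Cd_delta R X (val e)).
move=> /(congr1 (fun h => h (val e').2)).
rewrite [RHS]inner_conj !inner_delta !fctE /delta_vertex h eqxx.
rewrite [X in X = _]mulr1 [X in _ = Num.conj X]mulr1 => H2.
by rewrite /op_entry H2 conjCK.
Qed.

Lemma restricted_Phi_hom : @compact_hom R E A restricted1 restricted_Phi.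
Proof.
split.
- move=> S S' _ _ H; apply: eq_bigr => e _; apply: eq_bigr => e' _.
  by rewrite /op_entry H //; exact: Cd_delta.
- move=> k S S' _ _; rewrite /restricted_Phi scaler_sumr -big_split /=; apply: eq_bigr => e _.
  rewrite scaler_sumr -big_split /=; apply: eq_bigr => e' _.
  by rewrite scalerA -scalerDl.
- move=> S S' [[S1 adj] _] [[S1' adj'] _].
  rewrite /restricted_Phi cmul_suml big_seq [RHS]big_seq; apply: eq_bigr => e.
  rewrite in_edges_over => es; rewrite cmul_suml.
  transitivity (\sum_(e1 <- edges_over subsets) \sum_(e2 <- edges_over subsets)
     (op_entry S e e1 * op_entry S' e1 e2) *: (te (val e) ** (te (val e2))^#)).
    rewrite exchange_big /=; apply: eq_bigr => e2 _; rewrite -scaler_suml.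
    congr (_ *: _); rewrite /op_entry /= (op_entry_sum adj) //.
    by have [h _ _] := adj'; apply: h; exact: Cd_delta.
  apply: eq_big_seq => e1 e1s.
  rewrite cmul_sumr [RHS](bigD1_seq e1) ?fset_uniq //= [X in _ + X]big1 ?addr0 => [|e3 ne].
    rewrite cmul_sumr; apply: eq_bigr => e2 _; rewrite cmulZl cmulZr scalerA.
    have [h|h] := eqVneq (val e).2 (val e1).2; last first.
      by rewrite (op_entry_diag adj h) !mul0r !scale0r.
    congr (_ *: _); rewrite cmulA -(cmulA (te (val e))) (te_star_te HT) ?(valP e1) //.
    by rewrite eqxx scale1r (te_tv HT) h eqxx scale1r.
  rewrite cmul_sumr big1 // => e2 _; rewrite cmulZl cmulZr.
  rewrite cmulA -(cmulA (te (val e))) (te_star_te HT) ?(valP e1) //.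
  by rewrite (inj_eq val_inj) eq_sym (negbTE ne) scale0r cmula0 cmul0a !scaler0.
- move=> S S' _ _ adj; rewrite /restricted_Phi cstar_sum exchange_big /=.
  apply: eq_bigr => e _; rewrite cstar_sum; apply: eq_bigr => e' _.
  by rewrite cstarZ cstarM cstarK (adjoint_entry _ _ adj).
- move=> xi eta _ _; rewrite !restricted1E cstar_sum cmul_suml.
  apply: eq_bigr => e _; rewrite cmul_sumr; apply: eq_bigr => e' _.
  rewrite cstarZ cmulZl cmulZr scalerA.
  have [h|h] := eqVneq (val e).2 (val e').2; last first.
    by rewrite (te_te_star HT) // !scaler0.
  congr (_ *: _); rewrite /op_entry /theta inner_conj inner_delta fctE.
  by rewrite /delta_vertex -h eqxx; congr (_ * _); rewrite [X in Num.conj X]mulr1.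
Qed.

End RestrictedPair.

Section RestrictedCuntzKrieger.
Variables (R : realType) (X : choiceType) (A : cstarAlgType R).
Local Notation C := R[i].
Local Notation E := (finset_graph X).
Local Notation V := {fset X}.
Local Notation W := (finset_edge X).

Lemma vertex_fin_finset_graph : ~ countable [set: X] -> @vertex_fin E = set0.
Proof.
move=> uX; apply/seteqP; split => // v [/= U Uv /compact_discrete[F hF]].
apply: uX; apply: finite_set_countable.
have Uv' : U v by exact: nbhs_singleton Uv.
apply: (@sub_finite_set _ _ [set` (v `|` [fset (val e).1 | e in F])%fset]); last exact: finite_fset.
move=> x _ /=; rewrite inE; have [//|xv] := boolP (x \in v).
have xe : (x, (x |` v)%fset).1 \in (x, (x |` v)%fset).2 by rewrite /= fset1U1.
pose e : W := exist _ (x, (x |` v)%fset) xe.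
apply/orP; right; apply/imfsetP; exists e => //=.
apply: hF => /=; rewrite /ran /=.
by rewrite fsetU1K.
Qed.

Lemma restricted_cuntz_krieger (t0 : (V -> C) -> A) (t1 : (W -> C) -> A) (G : V) :
  ~ countable [set: X] -> @toeplitz_pair R E A t0 t1 ->
  @cuntz_krieger_pair R E A (restricted0 t0 G) (restricted1 t1 G).
Proof.
move=> uX HT; split; first exact: restricted_toeplitz.
exists (restricted_Phi t1 G); first exact: (@restricted_Phi_hom _ _ _ t0).
move=> f [_ f0]; have {f0}f0 v : f v = 0.
  by apply: f0; rewrite /vertex_rg vertex_fin_finset_graph // set0D.
have -> : f = fun=> 0 by apply/funext.
rewrite /restricted0 (_ : cutoff _ _ = fun=> 0); last by apply/funext => v; rewrite /cutoff; case: ifP.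
rewrite (t0_zero HT) /restricted_Phi big1 // => e _; rewrite big1 // => e' _.
by rewrite /op_entry /left_action mul0r scale0r.
Qed.

End RestrictedCuntzKrieger.

Section PathFrame.
Variables (R : realType) (X : choiceType) (A : cstarAlgType R).
Local Notation C := R[i].
Local Notation E := (finset_graph X).
Local Notation V := {fset X}.
Local Notation W := (finset_edge X).
Variables (t0 : (V -> C) -> A) (t1 : (W -> C) -> A).
Hypothesis HT : @toeplitz_pair R E A t0 t1.
Variable G : V.
Implicit Types (v w : V) (e : W) (q : X * V) (x y : X) (s : seq X).
Local Notation te := (te t1).
Local Notation tv := (tv t0).

(* The defect of the Cuntz-Krieger relation at v, for edges inside G. *)
Definition gap v : A :=
  tv v - \sum_(x <- enum_fset (G `\` v)%fset) te (x, (x |` v)%fset) ** (te (x, (x |` v)%fset))^#.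

Fixpoint path_range v s : V :=
  if s is x :: s' then (path_range v s' `\ x)%fset else v.

Fixpoint path_elt v s : A :=
  if s is x :: s' then te (x, path_range v s') ** path_elt v s' else gap v.

Lemma in_path_range v s x : (x \in path_range v s) = (x \in v) && (x \notin s).
Proof.
elim: s => [|y s IH] /=; first by rewrite andbT.
by rewrite !inE IH negb_or andbCA.
Qed.

Lemma path_range_sub v s : (path_range v s `<=` v)%fset.
Proof. by apply/fsubsetP => x; rewrite in_path_range => /andP[]. Qed.

Lemma gap_star v : (gap v)^# = gap v.
Proof.
rewrite /gap cstarB (tv_star HT) cstar_sum; congr (_ - _).
by apply: eq_bigr => x _; rewrite cstarM cstarK.
Qed.

Lemma tv_gap w v : tv w ** gap v = (w == v)%:R *: gap v.
Proof.
rewrite /gap cmulBr (tv_mul HT) cmul_sumr scalerBr scaler_sumr; congr (_ - _).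
  by case: eqP => [->|_] //; rewrite !scale0r.
rewrite big_seq [RHS]big_seq; apply: eq_bigr => x; rewrite inE => /andP[xv xG].
by rewrite cmulA (tv_te HT) /= fsetU1K // cmulZl.
Qed.

Lemma te_star_gap q v : (q.2 `<=` G)%fset -> (te q)^# ** gap v = 0.
Proof.
move=> qG; have [q1|q1] := boolP (q.1 \in q.2); last by rewrite (te_out HT) // cstar0 cmul0a.
rewrite /gap cmulBr cmul_sumr.
have h : (te q)^# = (te q)^# ** tv (q.2 `\ q.1)%fset.
  by rewrite -(tv_star HT) -cstarM (tv_te HT) eqxx scale1r.
have teq (r : X * V) : (te q)^# ** (te r ** (te r)^#) = (q == r)%:R *: (te q)^#.
  rewrite cmulA (te_star_te HT) // cmulZl; case: eqP => [<-|_]; last by rewrite !scale0r.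
  by rewrite !scale1r -(tv_star HT) -cstarM (te_tv HT) eqxx scale1r.
under eq_bigr do rewrite teq.
rewrite h -cmulA (tv_mul HT) cmulZr -h.
have [<-|ne] := eqVneq (q.2 `\ q.1)%fset v.
  rewrite (bigD1_seq q.1) ?fset_uniq //=; last first.
    by rewrite !inE eqxx /=; exact: (fsubsetP qG).
  rewrite fsetD1K // -surjective_pairing eqxx scale1r big1 ?addr0 ?subrr // => x ne.
  by case: eqP => [eq|_]; rewrite ?scale0r //; move: ne; rewrite eq eqxx.
rewrite scale0r big_seq big1 ?subr0 // => x; rewrite inE => /andP[xv _].
case: eqP => [eq|_]; rewrite ?scale0r //.
by move: ne; rewrite eq /= fsetU1K // eqxx.
Qed.

Lemma gap_idem v : (v `<=` G)%fset -> gap v ** gap v = gap v.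
Proof.
move=> vG; rewrite {1}/gap cmulBl tv_gap eqxx scale1r cmul_suml big_seq big1 ?subr0 //.
move=> x; rewrite inE => /andP[xv xG].
rewrite -cmulA te_star_gap ?cmula0 //= fsubUset vG andbT.
by rewrite fsub1set.
Qed.

Lemma tv_path w v s : tv w ** path_elt v s = (w == path_range v s)%:R *: path_elt v s.
Proof.
case: s => [|x s] /=; first exact: tv_gap.
by rewrite cmulA (tv_te HT) cmulZl.
Qed.

Lemma path_gap v s : (v `<=` G)%fset -> path_elt v s ** gap v = path_elt v s.
Proof.
by move=> vG; elim: s => [|x s IH] /=; [exact: gap_idem|rewrite -cmulA IH].
Qed.

Lemma te_path q v s :
  te q ** path_elt v s = (q.2 == path_range v s)%:R *: path_elt v (q.1 :: s).
Proof.
have -> : te q = te q ** tv q.2 by rewrite (te_tv HT) eqxx scale1r.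
rewrite -cmulA tv_path; case: q => x w /=; case: eqP => [->|_]; first by rewrite !scale1r.
by rewrite !scale0r cmula0.
Qed.

Lemma te_star_path q v x s :
  (te q)^# ** path_elt v (x :: s) = ((q == (x, path_range v s)) && (q.1 \in q.2))%:R *: path_elt v s.
Proof.
have [q1|q1] := boolP (q.1 \in q.2); last by rewrite (te_out HT) // cstar0 cmul0a andbF scale0r.
rewrite /= cmulA (te_star_te HT) // andbT cmulZl.
case: eqP => [->|_] /=; last by rewrite !scale0r.
by rewrite tv_path eqxx scale1r.
Qed.

Lemma path_orth v s s' : (v `<=` G)%fset -> s != s' -> (path_elt v s)^# ** path_elt v s' = 0.
Proof.
move=> vG.
have nil_cons x u : (path_elt v (x :: u))^# ** path_elt v [::] = 0.
  rewrite /= cstarM -cmulA te_star_gap ?cmula0 //=.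
  exact: fsubset_trans (path_range_sub v u) vG.
elim: s s' => [|x s IH] [|y s'] // ne.
- by apply: (can_inj (@cstarK _ A)); rewrite cstarM cstarK cstar0 nil_cons.
- rewrite [X in X^# ** _]/= cstarM -cmulA te_star_path.
  case: eqP => [[eq _]|_] /=; last by rewrite scale0r cmula0.
  by rewrite cmulZr IH ?scaler0 //; apply: contra ne => /eqP ->; rewrite eq.
Qed.

Lemma path_norm v s : (v `<=` G)%fset ->
  path_elt v s = 0 \/ (path_elt v s)^# ** path_elt v s = gap v.
Proof.
move=> vG; elim: s => [|x s IH]; first by right; rewrite /= gap_star gap_idem.
have [xs|xs] := boolP (x \in path_range v s); last first.
  by left; rewrite /= (te_out HT) // cmul0a.
case: IH => [h|h]; [left|right]; first by rewrite /= h cmula0.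
by rewrite [X in X^# ** _]/= cstarM -cmulA te_star_path eqxx xs scale1r.
Qed.

Lemma path_elt_neq0 v s : path_elt v s <> 0 -> uniq s /\ {subset s <= v}.
Proof.
elim: s => [_|x s IH h]; first by [].
have [xs|xs] := boolP (x \in path_range v s); last first.
  by case: h; rewrite /= (te_out HT) // cmul0a.
have [us sv] : uniq s /\ {subset s <= v}.
  by apply: IH => s0; apply: h; rewrite /= s0 cmula0.
move: xs; rewrite in_path_range /= => /andP[xv ->]; split => // y.
by rewrite inE => /predU1P[->|/sv].
Qed.

Definition path_index v : finType := (#|` v|).-bseq v.

Definition path_frame v (i : 'I_#|path_index v|) : A :=
  path_elt v (map val (enum_val i : path_index v)).
Arguments path_frame : clear implicits.

Lemma path_frame_surj v s : path_elt v s <> 0 -> exists i, path_frame v i = path_elt v s.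
Proof.
move=> h; have [us sv] := path_elt_neq0 h.
have mE : map val (pmap insub s : seq v) = s.
  rewrite pmap_filter => [|x]; last exact: insubK.
  by apply/all_filterP/allP => x /sv xv; rewrite insubT.
have sz : (size (pmap insub s : seq v) <= #|` v|)%N.
  by rewrite -(size_map val) mE; exact: (uniq_leq_size us).
pose b : path_index v := Bseq sz.
by exists (enum_rank b); rewrite /path_frame enum_rankK /= mE.
Qed.

Lemma path_frame_frame v : (v `<=` G)%fset -> frame (gap v) (path_frame v).
Proof.
move=> vG; split.
- exact: gap_star.
- move=> i j ij; apply: path_orth => //; apply: contra ij => /eqP.
  move=> /(inj_map val_inj) h; apply/eqP/enum_val_inj/val_inj; exact: h.
- by move=> i; exact: path_norm.
- by move=> i; exact: path_gap.
Qed.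

Lemma path_frame_scale v s (c : C) (j : 'I_#|path_index v|) :
  exists k (c' : C), c *: path_elt v s = c' *: path_frame v k.
Proof.
have [s0|/eqP/path_frame_surj[k <-]] := eqVneq (path_elt v s) 0.
  by exists j, 0; rewrite s0 scaler0 scale0r.
by exists k, c.
Qed.

Lemma tv_frame_algebra w v : (v `<=` G)%fset -> frame_algebra (gap v) (path_frame v) (tv w).
Proof.
move=> vG; apply: frame_algebra_mem; first exact: path_frame_frame.
  by move=> j; rewrite tv_path; exact: path_frame_scale.
by move=> j; rewrite (tv_star HT) tv_path; exact: path_frame_scale.
Qed.

Lemma te_frame_algebra q v : (v `<=` G)%fset -> (q.2 `<=` G)%fset ->
  frame_algebra (gap v) (path_frame v) (te q).
Proof.
move=> vG qG; apply: frame_algebra_mem; first exact: path_frame_frame.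
  by move=> j; rewrite te_path; exact: path_frame_scale.
move=> j; rewrite /path_frame; case: (map val _) => [|x s].
  by exists j, 0; rewrite /= te_star_gap // scale0r.
by rewrite te_star_path; exact: path_frame_scale.
Qed.

Lemma vanish_on_paths b : (forall v s, (v `<=` G)%fset -> b ** path_elt v s = 0) ->
  forall w, (w `<=` G)%fset -> b ** tv w = 0.
Proof.
move=> hb w; have [n] := ubnP #|` (G `\` w)%fset|.
elim: n => // n IH in b hb w *; rewrite ltnS => hn wG.
have -> : tv w = gap w + \sum_(x <- enum_fset (G `\` w)%fset)
    te (x, (x |` w)%fset) ** (te (x, (x |` w)%fset))^# by rewrite /gap subrK.
rewrite cmulDr (hb w [::] wG) add0r cmul_sumr big_seq big1 // => x.
rewrite inE => /andP[xw xG].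
set q := (x, _); have -> : te q = te q ** tv q.2 by rewrite (te_tv HT) eqxx scale1r.
rewrite !cmulA; have -> : b ** te q ** tv q.2 = 0; last by rewrite cmul0a.
apply: IH; last by rewrite /= fsubUset wG andbT fsub1set.
  by move=> v s vG; rewrite -cmulA te_path cmulZr hb // scaler0.
apply: leq_trans hn; apply: fproper_ltn_card.
rewrite fproperE; apply/andP; split.
  by apply/fsubsetP => y; rewrite !inE negb_or -andbA => /and3P[_ -> ->].
by apply/fsubsetPn; exists x; rewrite !inE ?eqxx ?xw.
Qed.

End PathFrame.

Lemma csa_sum (R : realType) (A : cstarAlgType R) (S : set A) (I : eqType) (r : seq I)
    (c : I -> R[i]) (F : I -> A) : closed_star_subalgebra S ->
  (forall i, i \in r -> S (F i)) -> S (\sum_(i <- r) c i *: F i).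
Proof.
move=> cS; elim: r => [_|i r IH h]; first by rewrite big_nil; exact: csa_zero cS.
rewrite big_cons; apply: (csa_linear cS); first by apply: h; rewrite mem_head.
by apply: IH => j jr; apply: h; rewrite inE jr orbT.
Qed.

Section GraphAlgebra.
Variables (R : realType) (X : choiceType) (A : cstarAlgType R).
Local Notation C := R[i].
Local Notation E := (finset_graph X).
Local Notation V := {fset X}.
Local Notation W := (finset_edge X).
Variables (t0 : (V -> C) -> A) (t1 : (W -> C) -> A).
Hypothesis HT : @toeplitz_pair R E A t0 t1.
Hypothesis HG : cstar_generated_by (t0 @` @C0 R E `|` t1 @` @Cd R E).
Implicit Types (f g : V -> C) (xi eta : W -> C) (v w G : V) (psi : A -> A).
Local Notation te := (te t1).
Local Notation tv := (tv t0).

Lemma t0_finite (s : seq V) f : uniq s ->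
  t0 (cutoff (fun v => v \in s) f) = \sum_(v <- s) f v *: tv v.
Proof.
elim: s => [_|a s IH /= /andP[as_ us]].
  have -> : cutoff (fun v => v \in [::]) f = fun=> 0 by apply/funext.
  by rewrite big_nil (t0_zero HT).
have -> : cutoff (fun v => v \in a :: s) f =
    f a *: delta_vertex R a + cutoff (fun v => v \in s) f.
  apply/funext => v; rewrite !fctE /cutoff /delta_vertex inE.
  have [->|va] := eqVneq v a; last by rewrite /= scaler0 add0r.
  by rewrite /= (negbTE as_) addr0 [RHS]mulr1.
rewrite big_cons (toeplitz_linear0 HT) ?IH //; first exact: C0_delta.
apply: (@C0_finite_support _ _ [fset v in s]%fset) => v.
by rewrite inE /cutoff => /negbTE ->.
Qed.

Record restriction G psi : Prop := {
  restriction_hom : star_hom psi;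
  restriction_t0 : forall f, @C0 R E f -> psi (t0 f) = restricted0 t0 G f;
  restriction_t1 : forall xi, @Cd R E xi -> psi (t1 xi) = restricted1 t1 G xi
}.

Lemma restriction_mem G psi (S : set A) : restriction G psi ->
  closed_star_subalgebra S ->
  (forall w, (w `<=` G)%fset -> S (tv w)) ->
  (forall q : X * V, (q.2 `<=` G)%fset -> S (te q)) ->
  forall b, S (psi b).
Proof.
move=> [hom h0 h1] cS Sv Se b.
have cP := csa_preimage hom cS.
suff : (psi @^-1` S) = setT by move=> /(congr1 (fun D : set A => D b)) /= ->.
apply: HG cP _ => _ [[f fC <-]|[xi xC <-]] /=.
  rewrite h0 // /restricted0 t0_finite ?fset_uniq //; apply: csa_sum => // w.
  by rewrite in_subsets; exact: Sv.
rewrite h1 // (restricted1E HT); apply: csa_sum => // e.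
by rewrite in_edges_over in_subsets; exact: Se.
Qed.

Lemma csa_right_unit (u : A) : closed_star_subalgebra [set b | b ** u = b /\ b^# ** u = b^#].
Proof.
have cl : closed [set b | b ** u = b].
  have -> : [set b | b ** u = b] = (fun b => b ** u - b) @^-1` [set b | exists c : C, b = c *: (0 : A)].
    apply/seteqP; split => b /=; first by move=> ->; exists 0; rewrite subrr scaler0.
    by move=> [c]; rewrite scaler0 => /eqP; rewrite subr_eq0 => /eqP.
  apply: (@lipschitz_closed_preimage _ _ _ _ (`|u| + 1) _ _ (closed_line (p := 0))) => a b.
  have -> : a ** u - a - (b ** u - b) = (a - b) ** u - (a - b).
    by rewrite cmulBl !opprB addrACA [RHS]addrACA [X in _ = _ + X]addrC.
  rewrite (le_trans (ler_normB _ _)) // mulrDl mul1r lerD // mulrC; exact: cnormM.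
split => [|||a b|a].
- apply: closedI => //; apply: (@lipschitz_closed_preimage _ _ _ cstar 1 _ _ cl) => a b.
  by rewrite mul1r -cstarB norm_cstar.
- by rewrite /= cstar0 cmul0a.
- move=> k a b [a1 a2] [b1 b2].
  by rewrite /= cstarD cstarZ !cmulDl !cmulZl a1 a2 b1 b2.
- by move=> [a1 a2] [b1 b2]; rewrite /= cstarM -!cmulA a2 b1.
- by move=> [a1 a2]; rewrite /= cstarK.
Qed.

Lemma restriction_faithful G psi b : restriction G psi ->
  (forall v s, (v `<=` G)%fset -> psi b ** path_elt t0 t1 G v s = 0) -> psi b = 0.
Proof.
move=> hpsi hb; pose one_ : V -> C := fun=> 1.
pose u := t0 (cutoff (fun v => v \in subsets G) one_).
have uC : @C0 R E (cutoff (fun v => v \in subsets G) one_).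
  by apply: (@C0_finite_support _ _ (fpowerset G)) => v; rewrite /cutoff => /negbTE ->.
have tvu w : (w `<=` G)%fset -> tv w ** u = tv w.
  by move=> wG; rewrite /u (tv_t0 HT) // /cutoff in_subsets wG scale1r.
have : [set b | b ** u = b /\ b^# ** u = b^#] (psi b).
  apply: (restriction_mem hpsi (csa_right_unit u)) => [w wG|q qG] /=.
    by rewrite (tv_star HT) tvu.
  have -> : te q = te q ** tv q.2 by rewrite (te_tv HT) eqxx scale1r.
  split; first by rewrite -cmulA tvu.
  have -> : te q ** tv q.2 = tv (q.2 `\ q.1)%fset ** te q.
    by rewrite (te_tv HT) (tv_te HT) !eqxx.
  rewrite cstarM (tv_star HT) -cmulA tvu //.
  by rewrite (fsubset_trans _ qG) // fsubD1set.
move=> [<- _]; rewrite /u t0_finite ?fset_uniq // cmul_sumr big_seq big1 // => w.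
rewrite in_subsets => wG; rewrite cmulZr.
by rewrite (vanish_on_paths HT hb) ?scaler0.
Qed.

Definition approximable : set A := [set a | forall eps : C, 0 < eps ->
  exists F : V, forall G psi, (F `<=` G)%fset -> restriction G psi -> `|psi a - a| <= eps].

Lemma approximableP a (M : C) : 0 <= M -> (forall eps : C, 0 < eps ->
  exists F : V, forall G psi, (F `<=` G)%fset -> restriction G psi -> `|psi a - a| <= M * eps) ->
  approximable a.
Proof.
move=> M0 h eps e0; have M1 : 0 < M + 1 by rewrite ltr_wpDl.
have [F hF] := h (eps / (M + 1)) (divr_gt0 e0 M1).
exists F => G psi FG hp; apply: le_trans (hF G psi FG hp) _.
rewrite mulrCA ler_piMr ?(ltW e0) // ler_pdivrMr // mul1r lerDl ler01 //.
Qed.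

Lemma csa_approximable : closed_star_subalgebra approximable.
Proof.
split.
- apply: closed_of_approx => a ha; apply: (@approximableP _ 3) => // eps e0.
  have [b hb ab] := ha eps e0; have [F hF] := hb eps e0.
  exists F => G psi FG hp; have hom := restriction_hom hp.
  have -> : psi a - a = psi (a - b) + (psi b - b) + (b - a).
    by rewrite (star_homB hom) subrKA subrKA.
  have -> : 3 * eps = eps + eps + eps by ring.
  rewrite (le_trans (ler_normD _ _)) // lerD //; last by rewrite distrC ltW.
  rewrite (le_trans (ler_normD _ _)) // lerD //; last exact: (hF _ _ FG hp).
  by rewrite (le_trans (norm_star_hom hom _)) // ltW.
- move=> eps e0; exists fset0 => G psi _ hp.
  by rewrite (star_hom0 (restriction_hom hp)) subrr normr0 ltW.
- move=> k a b ha hb; apply: (@approximableP _ (`|k| + 1)) => [|eps e0]; first by rewrite addr_ge0.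
  have [F hF] := ha eps e0; have [F' hF'] := hb eps e0.
  exists (F `|` F')%fset => G psi; rewrite fsubUset => /andP[FG FG'] hp.
  rewrite (star_hom_linear (restriction_hom hp)) opprD addrACA -scalerBr.
  rewrite (le_trans (ler_normD _ _)) // mulrDl mul1r normrZ lerD //; last exact: (hF' _ _ FG' hp).
  by rewrite ler_wpM2l // (hF _ _ FG hp).
- move=> a b ha hb; apply: (@approximableP _ (`|a| + `|b|)) => [|eps e0]; first by rewrite addr_ge0.
  have [F hF] := ha eps e0; have [F' hF'] := hb eps e0.
  exists (F `|` F')%fset => G psi; rewrite fsubUset => /andP[FG FG'] hp.
  have hom := restriction_hom hp.
  have -> : psi (a ** b) - a ** b = psi a ** (psi b - b) + (psi a - a) ** b.
    by rewrite (star_hom_mul hom) cmulBr cmulBl subrKA.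
  rewrite (le_trans (ler_normD _ _)) // mulrDl lerD // (le_trans (cnormM _ _)) //.
    by rewrite ler_pM // ?norm_star_hom // (hF' _ _ FG' hp).
  by rewrite mulrC ler_wpM2l // (hF _ _ FG hp).
- move=> a ha eps e0; have [F hF] := ha eps e0.
  exists F => G psi FG hp.
  by rewrite (star_hom_star (restriction_hom hp)) -cstarB norm_cstar (hF _ _ FG hp).
Qed.

Lemma C0_tail f (eps : C) : 0 < eps -> @C0 R E f ->
  exists F : V, forall G, (F `<=` G)%fset ->
    forall v, `|cutoff (fun v => v \notin subsets G) f v| <= eps.
Proof.
move=> e0 /C0P/(_ _ e0)[S hS]; exists (\bigcup_(v <- enum_fset S) v)%fset => G SG v.
rewrite /cutoff in_subsets; case: ifPn => [vG|_]; last by rewrite normr0 ltW.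
apply/ltW/hS; apply: contra vG => vS; apply: fsubset_trans SG.
exact: (@bigfcup_sup _ _ (enum_fset S) v xpredT id).
Qed.

Lemma approximable_setT : approximable = setT.
Proof.
apply: HG csa_approximable _ => _ [[f fC <-]|[xi xC <-]].
  move=> eps e0; have [F hF] := C0_tail e0 fC.
  exists F => G psi /hF h hp; rewrite (restriction_t0 hp) // distrC /restricted0.
  rewrite -(t0B HT) //; last exact: C0_cutoff.
  have -> : f - cutoff (fun v => v \in subsets G) f = cutoff (fun v => v \notin subsets G) f.
    apply/funext => v; rewrite !fctE /cutoff.
    by case: (v \in _); rewrite /= ?subrr ?subr0.
  apply: (norm_t0_le HT) => //; exact: C0_cutoff.
move=> eps e0; have e20 : 0 < eps ^+ 2 by rewrite exprn_gt0.
have [F hF] := C0_tail e20 (Cd_inner xC).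
exists F => G psi /hF h hp; rewrite (restriction_t1 hp) // distrC /restricted1.
have xGC : @Cd R E (cutoff (fun e : W => (val e).2 \notin subsets G) xi).
  exact: (Cd_cutoff (fun v => v \notin subsets G)).
rewrite -(t1B HT) //; last exact: (Cd_cutoff (fun v => v \in subsets G)).
have -> : xi - cutoff (fun e : W => (val e).2 \in subsets G) xi =
    cutoff (fun e : W => (val e).2 \notin subsets G) xi.
  apply/funext => e; rewrite !fctE /cutoff.
  by case: (_ \in _); rewrite /= ?subrr ?subr0.
rewrite -ler_sqr ?nnegrE //; last exact: ltW.
rewrite -cnorm_star (toeplitz_inner HT) //.
rewrite (inner_cutoff (fun v => v \notin subsets G) (fun v => v \notin subsets G)).
rewrite (_ : (fun v => _ && _) = (fun v => v \notin subsets G)); last first.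
  by apply/funext => v; rewrite andbb.
apply: (norm_t0_le HT) => //; exact/C0_cutoff/Cd_inner.
Qed.

End GraphAlgebra.

Theorem proposition13p10 (R : realType) (X : choiceType)
    (X_uncountable : ~ countable [set: X]%classic)
    (A : cstarAlgType R)
    (t0 : (vertex (finset_graph X) -> R[i]%type) -> A)
    (t1 : (edge (finset_graph X) -> R[i]%type) -> A)
    (OE : is_graph_algebra t0 t1) :
  residually_finite_dimensional A.
Proof.
have [[HT _] HG HU] := OE.
have ex G : exists psi, restriction t0 t1 G psi.
  have [psi [hom h0 h1]] := HU _ _ _ (restricted_cuntz_krieger G X_uncountable HT).
  by exists psi.
move=> a b ab; apply: contrapT => H; apply: ab; apply/eqP; rewrite -subr_eq0; apply/eqP.
have kill G psi : restriction t0 t1 G psi -> psi (a - b) = 0.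
  move=> hp; apply: (restriction_faithful HT HG hp) => v s vG.
  have [|rho [rep hr]] := frame_representation (path_frame_frame HT vG) (restriction_hom hp).
    move=> c; apply: (restriction_mem HT HG hp).
    - by apply: csa_frame_algebra; exact: path_frame_frame.
    - by move=> w _; exact: tv_frame_algebra.
    - by move=> q qG; exact: te_frame_algebra.
  have rab : rho (a - b) = 0.
    rewrite -scaleN1r addrC (matrix_rep_linear rep) scaleN1r addrC.
    apply/eqP; rewrite subr_eq0; apply/eqP; apply: contrapT => ne.
    by apply: H; exists _, rho.
  have [s0|/eqP/(path_frame_surj HT)[k <-]] := eqVneq (path_elt t0 t1 G v s) 0.
    by rewrite s0 cmula0.
  exact: hr.
apply: (@norm_eps_eq0 _ _ _ 1) => // eps e0.
have : approximable t0 t1 (a - b) by rewrite (approximable_setT HT HG).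
move=> /(_ eps e0)[F hF]; have [psi hp] := ex F.
by have := hF _ _ (fsubset_refl F) hp; rewrite (kill _ _ hp) sub0r normrN mul1r.
Qed.
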